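(* Let $\Bbbk$ be a field of characteristic zero. The variety of pre-Lie algebras over $\Bbbk$ has the Nielsen–Schreier property, i.e. every subalgebra of every free pre-Lie algebra is a free pre-Lie algebra.
   Context: A pre-Lie (right-symmetric) algebra over $\Bbbk$ is a $\Bbbk$-vector space with a bilinear product satisfying the identity $(a_1a_2)a_3-a_1(a_2a_3)=(a_1a_3)a_2-a_1(a_3a_2)$. *)

(* Defs.v *)
From HB Require Import structures.
From mathcomp Require Import all_boot all_algebra.
From mathcomp Require Import boolp classical_sets.

Set Implicit Arguments.
Unset Strict Implicit.
Unset Printing Implicit Defensive.

Import GRing.Theory.
Local Open Scope ring_scope.

(* Right-symmetric (right pre-Lie) algebras: the associator
   (a b) c - a (b c) is symmetric in its last two arguments. *)
HB.mixin Record Lmodule_isPreLie (k : fieldType) A of GRing.Lmodule k A := {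
  plmul : A -> A -> A;
  plmul_linearl : forall b, linear (plmul^~ b);
  plmul_linearr : forall a, linear (plmul a);
  plmul_rsym : forall a1 a2 a3,
    plmul (plmul a1 a2) a3 - plmul a1 (plmul a2 a3) =
    plmul (plmul a1 a3) a2 - plmul a1 (plmul a3 a2)
}.

#[short(type="preLieType")]
HB.structure Definition PreLie (k : fieldType) :=
  {A of GRing.Lmodule k A & Lmodule_isPreLie k A}.

Definition prelie_morphism (k : fieldType) (A B : preLieType k) (f : A -> B) :=
  linear f /\ {morph f : x y / plmul x y}.

Definition free_on (k : fieldType) (A : preLieType k) (X : Type) (i : X -> A) :=
  forall (B : preLieType k) (f : X -> B),
    exists phi : A -> B,
      [/\ prelie_morphism phi, forall x, phi (i x) = f x &
          forall psi : A -> B, prelie_morphism psi ->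
            (forall x, psi (i x) = f x) -> psi =1 phi].

Definition is_free (k : fieldType) (A : preLieType k) : Prop :=
  exists (X : Type) (i : X -> A), free_on i.

(* The carrier is a Prop-valued classical set, so that no decidability of
   membership is assumed. *)
Record subPreLie (k : fieldType) (A : preLieType k) := SubPreLie {
  subprelie_set :> set A;
  subprelie0 : subprelie_set 0;
  subprelieD : forall x y,
    subprelie_set x -> subprelie_set y -> subprelie_set (x + y);
  subprelieZ : forall (a : k) x, subprelie_set x -> subprelie_set (a *: x);
  subprelieM : forall x y,
    subprelie_set x -> subprelie_set y -> subprelie_set (plmul x y)
}.

Definition subprelie_type (k : fieldType) (A : preLieType k)
  (S : subPreLie A) : Type := {x : A | x \in subprelie_set S}.

Section SubPreLieTheory.
Variables (k : fieldType) (A : preLieType k) (S : subPreLie A).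

Lemma subprelie_closed : subsemimod_closed (fun x : A => x \in subprelie_set S).
Proof.
split; first split.
- exact/mem_set/subprelie0.
- by move=> x y /set_mem Sx /set_mem Sy; apply/mem_set/subprelieD.
- by move=> a x /set_mem Sx; apply/mem_set/subprelieZ.
Qed.

HB.instance Definition _ := [isSub of subprelie_type S for sval].
HB.instance Definition _ := [Choice of subprelie_type S by <:].
HB.instance Definition _ :=
  GRing.SubChoice_isSubLmodule.Build k A (fun x : A => x \in subprelie_set S)
    (subprelie_type S) subprelie_closed.

Lemma subprelie_mulP (u v : subprelie_type S) :
  plmul (val u) (val v) \in subprelie_set S.
Proof. by apply/mem_set/subprelieM; apply/set_mem/valP. Qed.

Definition subprelie_mul (u v : subprelie_type S) : subprelie_type S :=
  exist _ (plmul (val u) (val v)) (subprelie_mulP u v).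

Fact subprelie_mul_linearl v : linear (subprelie_mul^~ v).
Proof. by move=> a x y; apply: val_inj; rewrite !linearP /= plmul_linearl. Qed.

Fact subprelie_mul_linearr u : linear (subprelie_mul u).
Proof. by move=> a x y; apply: val_inj; rewrite !linearP /= plmul_linearr. Qed.

Fact subprelie_mul_rsym u v w :
  subprelie_mul (subprelie_mul u v) w - subprelie_mul u (subprelie_mul v w) =
  subprelie_mul (subprelie_mul u w) v - subprelie_mul u (subprelie_mul w v).
Proof. by apply: val_inj; rewrite !linearB /= plmul_rsym. Qed.

HB.instance Definition _ := Lmodule_isPreLie.Build k (subprelie_type S)
  subprelie_mul_linearl subprelie_mul_linearr subprelie_mul_rsym.

Lemma val_plmul (u v : subprelie_type S) :
  val (plmul u v) = plmul (val u) (val v).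
Proof. by []. Qed.

End SubPreLieTheory.

(* The Nielsen-Schreier property for the variety of pre-Lie algebras over k. *)
Definition prelie_nielsen_schreier (k : fieldType) : Prop :=
  forall (A : preLieType k), is_free A ->
  forall (S : subPreLie A), is_free (subprelie_type S).

(* Main.v *)
From HB Require Import structures.
Require Import Defs.
From mathcomp Require Import all_boot all_algebra.
From mathcomp Require Import boolp classical_sets functions.

Set Implicit Arguments.
Unset Strict Implicit.
Unset Printing Implicit Defensive.

Import GRing.Theory.
Local Open Scope ring_scope.

(** Why subalgebras of free pre-Lie algebras are free.

    Write [s, t] = st - ts.  The pre-Lie identity says that a subalgebra L acts
    on A by right multiplications as a Lie algebra.  A positively graded
    pre-Lie algebra L is free as soon as every relation sum a_i b_i = 0 in L is
    a consequence of the identity.  Dually: every bilinear g : L x L -> N with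
    g(as, t) - g(at, s) = g(a, [s, t]) must have the form g(a, s) = h(as).
    This is the vanishing of the first cohomology of the Lie algebra L with
    coefficients in Hom(L, N).  [H1vanish m] states it for cochains that vanish
    in degrees above m, and it is proved by induction on m.  Working with
    cochains, which are plain functions, avoids tensor products; a polynomial
    function on a vector space E is encoded by its symmetric multilinear
    components, as one function on sequences of elements of E.

    The induction uses three facts about a graded subalgebra L of a free A.

    - Cocycles A x L -> N are coboundaries ([relative_H1]): A is a free right
      module over its enveloping algebra, hence over that of L.  The universal
      property of A, applied to a suitable coinduced pre-Lie algebra, reduces
      this to the Poincare-Birkhoff-Witt theorem ([pbw]), which is explicit for
      pre-Lie algebras.

    - [H1vanish m] kills the second cohomology of L in degrees up to m, with any
      coefficients ([H2_vanish]).  This is the assertion that L is free as a Lie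
      algebra.  The symmetric power S^n(L) is a direct summand of
      L (x) S^(n-1)(L), so its first cohomology vanishes when that of L does, and
      the enveloping algebra of L is filtered by the S^n(L).  Both the splitting
      and the Koszul homotopy divide by n, which needs characteristic zero.

    - The obstruction to extending a cocycle of L to a cocycle A x L -> N lies in
      the second cohomology of L with coefficients in Hom(A/L, N); since degrees
      in A are positive, [H1vanish m] disposes of it for cocycles of degree m + 1
      ([H1vanish_succ]).

    A subalgebra S need not be homogeneous.  The preceding applies to the algebra
    gr S of its top-degree components; lifting to S a homogeneous basis of a
    complement of the products in gr S gives free generators of S, because
    [H1vanish] is exactly what extends a morphism from degree m to degree m + 1
    ([partial_extend], [lifted_free]). *)

(** * Identities in abelian groups *)


Section Zmodule.
Variable V : zmodType.

Inductive zexp := ZVar of nat | ZZero | ZAdd of zexp & zexp | ZOpp of zexp.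

Fixpoint zeval (env : seq V) e : V :=
  match e with
  | ZVar n => nth 0 env n
  | ZZero => 0
  | ZAdd a b => zeval env a + zeval env b
  | ZOpp a => - zeval env a
  end.

Fixpoint zaddc (s t : seq int) :=
  match s, t with
  | [::], _ => t
  | _, [::] => s
  | a :: s', b :: t' => (a + b)%R :: zaddc s' t'
  end.

Fixpoint zcoef e : seq int :=
  match e with
  | ZVar n => ncons n 0 [:: 1]
  | ZZero => [::]
  | ZAdd a b => zaddc (zcoef a) (zcoef b)
  | ZOpp a => map -%R (zcoef a)
  end.

Fixpoint zlin (env : seq V) (s : seq int) {struct s} : V :=
  match s, env with
  | c :: s', x :: env' => x *~ c + zlin env' s'
  | _, _ => 0
  end.

Lemma zlin_coef env e : zlin env (zcoef e) = zeval env e.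
Proof.
elim: e => [n||a IHa b IHb|a IHa] /=; try (rewrite -IHa; clear IHa);
  try (rewrite -IHb; clear IHb).
- elim: env n => [|x env IH] [|n] //=; first by rewrite addr0.
  by rewrite mulr0z add0r.
- by case: env.
- elim: (zcoef a) (zcoef b) env => [|x s IH] [|y t] [|z env] //=;
    rewrite ?addr0 ?add0r // mulrzDr IH; exact: addrACA.
- elim: (zcoef a) env => [|x s IH] [|z env] //=; rewrite ?oppr0 //.
  by rewrite mulrNz opprD IH.
Qed.

Lemma zmod_eq env a b :
  all (pred1 0) (zcoef (ZAdd a (ZOpp b))) -> zeval env a = zeval env b.
Proof.
move=> H; apply/eqP; rewrite -subr_eq0; apply/eqP.
rewrite -[LHS]/(zeval env (ZAdd a (ZOpp b))) -zlin_coef.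
elim: (zcoef _) env H => [|x s IH] [|z env] //= /andP[/eqP-> /IH->].
by rewrite mulr0z addr0.
Qed.

End Zmodule.

Ltac zm_vars e xs :=
  lazymatch e with
  | (?a + ?b) => let ys := zm_vars a xs in zm_vars b ys
  | (- ?a) => zm_vars a xs
  | 0 => xs
  | _ => let rec mem l :=
           lazymatch l with
           | nil => constr:(false)
           | ?y :: ?l' => match constr:(Set) with
                          | _ => let _ := constr:(erefl e : e = y) in constr:(true)
                          | _ => mem l'
                          end
           end in
         let b := mem xs in
         lazymatch b with true => xs | false => constr:(e :: xs) end
  end.

Ltac zm_index e xs :=
  match xs with
  | ?y :: ?l => match constr:(Set) with
                | _ => let _ := constr:(erefl e : e = y) in constr:(0%N)
                | _ => let n := zm_index e l in constr:(n.+1)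
                end
  end.

Ltac zm_reify e xs :=
  lazymatch e with
  | (?a + ?b) => let p := zm_reify a xs in let q := zm_reify b xs in
                 constr:(ZAdd p q)
  | (- ?a) => let p := zm_reify a xs in constr:(ZOpp p)
  | 0 => constr:(ZZero)
  | _ => let n := zm_index e xs in constr:(ZVar n)
  end.

(** Decides the identities that hold in every abelian group. *)
Ltac zmod :=
  lazymatch goal with
  | |- @eq ?T ?a ?b =>
      let xs0 := zm_vars a (@nil T) in
      let xs := zm_vars b xs0 in
      let p := zm_reify a xs in
      let q := zm_reify b xs in
      refine (@zmod_eq _ xs p q _); vm_compute; reflexivity
  end.

(** * Linear algebra in arbitrary dimension *)

Section LinearMaps.
Variables (k : fieldType) (U V : lmodType k) (f : U -> V).
Hypothesis fL : linear f.

Lemma lin0 : f 0 = 0.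
Proof. by have := fL (-1) 0 0; rewrite scaleN1r scaleN1r addr0 oppr0 addNr. Qed.

Lemma linZ c x : f (c *: x) = c *: f x.
Proof. by have := fL c x 0; rewrite !addr0 lin0 addr0. Qed.

Lemma linD x y : f (x + y) = f x + f y.
Proof. by have := fL 1 x y; rewrite !scale1r. Qed.

Lemma linN x : f (- x) = - f x.
Proof. by rewrite -scaleN1r linZ scaleN1r. Qed.

Lemma linB x y : f (x - y) = f x - f y.
Proof. by rewrite linD linN. Qed.

Lemma lin_sum I (r : seq I) (P : pred I) (F : I -> U) :
  f (\sum_(i <- r | P i) F i) = \sum_(i <- r | P i) f (F i).
Proof. by apply: (big_morph f linD lin0). Qed.

End LinearMaps.

Section Span.
Variable k : fieldType.

Inductive span (V : lmodType k) (P : V -> Prop) : V -> Prop :=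
| span0 : span P 0
| span_cons c x y : P x -> span P y -> span P (c *: x + y).

Definition subspace (V : lmodType k) (Q : V -> Prop) :=
  Q 0 /\ forall c x y, Q x -> Q y -> Q (c *: x + y).

Lemma span_sub (V : lmodType k) (P Q : V -> Prop) :
  subspace Q -> (forall x, P x -> Q x) -> forall x, span P x -> Q x.
Proof.
move=> [Q0 QL] PQ x; elim=> // c y z Py _ Qz.
by apply: QL => //; apply: PQ.
Qed.

Lemma span_gen (V : lmodType k) (P : V -> Prop) x : P x -> span P x.
Proof.
by move=> Px; rewrite -[x]addr0 -[x]scale1r; apply: span_cons Px _; apply: span0.
Qed.

Lemma span_subspace (V : lmodType k) (P : V -> Prop) : subspace (span P).
Proof.
split=> [|c x y]; first exact: span0.
elim=> [|d z t Pz _ IH] Sy; first by rewrite scaler0 add0r.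
by rewrite scalerDr -addrA scalerA; apply: span_cons Pz _; apply: IH.
Qed.

Lemma span_mono (V : lmodType k) (P Q : V -> Prop) x :
  (forall y, P y -> Q y) -> span P x -> span Q x.
Proof.
move=> PQ; apply: span_sub; first exact: span_subspace.
by move=> y /PQ; apply: span_gen.
Qed.

Section Subspace.
Variables (V : lmodType k) (Q : V -> Prop).
Hypothesis Qs : subspace Q.

Lemma sub_0 : Q 0. Proof. by case: Qs. Qed.

Lemma sub_Z c x : Q x -> Q (c *: x).
Proof. by case: Qs => Q0 QL Qx; rewrite -[_ *: _]addr0; apply: QL. Qed.

Lemma sub_D x y : Q x -> Q y -> Q (x + y).
Proof. by case: Qs => Q0 QL Qx Qy; rewrite -[x]scale1r; apply: QL. Qed.

Lemma sub_N x : Q x -> Q (- x).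
Proof. by move=> Qx; rewrite -scaleN1r; apply: sub_Z. Qed.

Lemma sub_B x y : Q x -> Q y -> Q (x - y).
Proof. by move=> Qx Qy; apply: sub_D => //; apply: sub_N. Qed.

Lemma sub_sum I (r : seq I) (P : pred I) (F : I -> V) :
  (forall i, P i -> Q (F i)) -> Q (\sum_(i <- r | P i) F i).
Proof. by move=> H; apply: big_ind => //; [exact: sub_0 | exact: sub_D]. Qed.

End Subspace.

Lemma eq_linear_sub (U V : lmodType k) (f g : U -> V) :
  linear f -> linear g -> subspace (fun x => f x = g x).
Proof.
move=> fL gL; split=> [|c x y fx fy]; first by rewrite (lin0 fL) (lin0 gL).
by rewrite fL gL fx fy.
Qed.

(** The linear relation that sends D to 0 and is f on X. *)
Definition graph (V N : lmodType k) (D X : V -> Prop) (f : V -> N) (p : V * N) :=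
  (D p.1 /\ p.2 = 0) \/ (X p.1 /\ p.2 = f p.1).

(** X is linearly independent modulo D.  Quantifying over all target spaces
    makes independence of a union of a chain immediate and lets a maximal X
    carry linear extensions, with no mention of finite linear combinations. *)
Definition indep (V : lmodType k) (D X : V -> Prop) :=
  forall (N : lmodType k) (f : V -> N) n, span (graph D X f) (0, n) -> n = 0.

(** A derivation of (0, n) uses finitely many elements of the union, so it
    already lives in one member of the chain. *)
Lemma indep_chain (V : lmodType k) (D : V -> Prop) (F : set (set V)) :
  subspace D ->
  (forall X, F X -> indep D X) -> total_on F subset ->
  indep D (\bigcup_(X in F) X)%classic.
Proof.
move=> Ds FI Ftot N f n Sn.
have [X [FX SX]] : exists X, (X = set0 \/ F X) /\ span (graph D X f) (0, n).
  elim: Sn => [|c p q Gp _ [X [FX Sq]]].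
    by exists set0; split; [left | apply: span0].
  case: Gp => [Dp|[[Y FY Yp] p2]].
    by exists X; split=> //; apply: span_cons Sq; left.
  have Yq (Z : set V) : F Z -> (Y `<=` Z)%classic -> (X `<=` Z)%classic ->
      exists Z0, (Z0 = set0 \/ F Z0) /\ span (graph D Z0 f) (c *: p + q).
    move=> FZ YZ XZ; exists Z; split; first by right.
    apply: span_cons; first by right; split=> //; apply: YZ.
    by apply: span_mono Sq => r [Dr|[Xr r2]]; [left | right; split=> //; apply: XZ].
  case: FX => [X0|FX]; first by apply: (Yq Y) => //; rewrite X0; apply: sub0set.
  by case: (Ftot _ _ FX FY) => H; [apply: (Yq Y) | apply: (Yq X)].
case: FX => [X0|FX]; last exact: FI SX.
suff: forall p, span (graph D X f) p -> p.2 = 0 by move=> /(_ _ SX).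
apply: span_sub => [|p [[//]|[]]]; last by rewrite X0.
by split=> // c p q; rewrite /= => -> ->; rewrite scaler0 addr0.
Qed.

(** Zorn's lemma gives a maximal X.  It spans with D: if x were outside the span,
    adding x would keep the relation single-valued, because an element of it
    over 0 involves x with coefficient 0. *)
Theorem basis (V : lmodType k) (D : V -> Prop) : subspace D ->
  exists X : V -> Prop, (forall x, span (fun y => D y \/ X y) x) /\
  forall (N : lmodType k) (f : V -> N), exists h : V -> N,
    [/\ linear h, forall x, D x -> h x = 0 & forall x, X x -> h x = f x].
Proof.
move=> Ds.
have [|X [XI Xmax]] := @Zorn_bigcup V (fun X => indep D X).
  by move=> F FI Ftot; apply: indep_chain.
have Xspan x : span (fun y => D y \/ X y) x.
  apply: contrapT => Sx.
  apply: (Xmax (fun y => X y \/ y = x)).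
    split=> [y|]; first by left.
    by move=> /(_ x (or_intror erefl)) Xx; apply: Sx; apply: span_gen; right.
  move=> N f n Sn.
  suff [c [Sc Sd]] : exists c, span (graph D X f) ((0, n) - c *: (x, f x)) /\
       span (fun y => D y \/ X y) (0 - c *: x).
    case: (eqVneq c 0) => [c0|cN0].
      by move: Sc; rewrite c0 scale0r subr0; apply: XI.
    case: Sx; have -> : x = (- c^-1) *: (0 - c *: x).
      by rewrite sub0r scalerN scaleNr opprK scalerA mulVf ?scale1r.
    by apply: sub_Z Sd; apply: span_subspace.
  suff: forall p, span (graph D (fun y => X y \/ y = x) f) p -> exists c,
      span (graph D X f) (p - c *: (x, f x)) /\
      span (fun y => D y \/ X y) (p.1 - c *: x) by move=> /(_ _ Sn).
  move=> p; elim=> [|d q r Gq _ [c [Sr Sr1]]].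
    by exists 0; rewrite !scale0r !subr0; split; apply: span0.
  case: Gq => [Dq|[[Xq|xq] q2]].
  - exists c; rewrite -!addrA; split; apply: span_cons => //; first by left.
    by left; case: Dq.
  - exists c; rewrite -!addrA; split; apply: span_cons => //; first by right.
    by right.
  - have -> : q = (x, f x) by case: q q2 xq {Sn} => q1 q3 /= -> ->.
    exists (d + c); rewrite !scalerDl !opprD /=.
    have E (W : lmodType k) (a b e : W) : a + b + (- a - e) = b - e.
      by rewrite addrACA subrr add0r.
    by rewrite !E.
exists X; split=> // N f.
have tot x : exists n, span (graph D X f) (x, n).
  elim: (Xspan x) => [|c y z DXy _ [n Sn]]; first by exists 0; apply: span0.
  case: DXy => [Dy|Xy].
    by exists (c *: 0 + n); apply: (@span_cons _ _ c (y, 0) (z, n)) => //; left.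
  by exists (c *: f y + n); apply: (@span_cons _ _ c (y, f y) (z, n)) => //; right.
have func x n n' : span (graph D X f) (x, n) -> span (graph D X f) (x, n') -> n = n'.
  move=> Sn Sn'; apply/eqP; rewrite -subr_eq0; apply/eqP; apply: (XI N f).
  have := sub_B (span_subspace _) Sn Sn'.
  by have -> : (x, n) - (x, n') = (x - x, n - n') by []; rewrite subrr.
pose h x := projT1 (cid (tot x)).
have hP x : span (graph D X f) (x, h x) by rewrite /h; case: cid.
exists h; split=> [c x y|x Dx|x Xx].
- apply: func (hP _) _.
  by case: (span_subspace (graph D X f)) => _ /(_ c _ _ (hP x) (hP y)).
- by apply: func (hP _) _; apply: span_gen; left.
- by apply: func (hP _) _; apply: span_gen; right.
Qed.

Corollary projection (V : lmodType k) (D : V -> Prop) : subspace D ->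
  exists p : V -> V, [/\ linear p, forall x, D (p x) & forall x, D x -> p x = x].
Proof.
move=> Ds; have [X [Xspan Xext]] := basis Ds.
have [h [hL hD hX]] := Xext V id.
exists (fun x => x - h x); split=> [c x y|x|x /hD->]; last by rewrite subr0.
- by rewrite hL opprD scalerBr addrACA.
- elim: (Xspan x) => [|c y z DXy _ IH]; first by rewrite (lin0 hL) subr0; apply: (sub_0 Ds).
  rewrite hL opprD addrACA -scalerBr; case: Ds => D0 DL; apply: DL => //.
  by case: DXy => [Dy|Xy]; [rewrite hD ?subr0 | rewrite hX ?subrr].
Qed.

(** The selection is chosen on a basis, then extended. *)
Corollary linear_selection (U V : lmodType k) (R : U -> V -> Prop) :
  R 0 0 -> (forall c x y v w, R x v -> R y w -> R (c *: x + y) (c *: v + w)) ->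
  (forall x, exists v, R x v) ->
  exists s : U -> V, linear s /\ forall x, R x (s x).
Proof.
move=> R0 RL Rtot.
have D0 : subspace (fun x : U => x = 0).
  by split=> // c x y -> ->; rewrite scaler0 addr0.
have [X [Xspan Xext]] := basis D0.
have [s [sL _ sX]] := Xext V (fun x => projT1 (cid (Rtot x))).
exists s; split=> // x; elim: (Xspan x) => [|c y z DXy _ IH]; first by rewrite (lin0 sL).
rewrite sL; apply: RL => //; case: DXy => [->|Xy]; first by rewrite (lin0 sL).
by rewrite sX //; case: cid.
Qed.

End Span.

(** * Right multiplications and symmetric multilinear functions *)

Notation "x ** y" := (plmul x y) (at level 40, left associativity) : ring_scope.

Section PreLieBasics.
Variables (k : fieldType) (A : preLieType k).
Implicit Types x y z : A.

Definition lie x y := x ** y - y ** x.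

Lemma pm0l x : 0 ** x = 0. Proof. exact: (lin0 (plmul_linearl x)). Qed.
Lemma pm0r x : x ** 0 = 0. Proof. exact: (lin0 (plmul_linearr x)). Qed.
Lemma pmBl z x y : (x - y) ** z = x ** z - y ** z.
Proof. exact: (linB (plmul_linearl z)). Qed.
Lemma pmBr z x y : z ** (x - y) = z ** x - z ** y.
Proof. exact: (linB (plmul_linearr z)). Qed.
Lemma pm_suml I (r : seq I) (P : pred I) (F : I -> A) z :
  (\sum_(i <- r | P i) F i) ** z = \sum_(i <- r | P i) F i ** z.
Proof. exact: (lin_sum (plmul_linearl z)). Qed.
Lemma pm_sumr I (r : seq I) (P : pred I) (F : I -> A) z :
  z ** (\sum_(i <- r | P i) F i) = \sum_(i <- r | P i) z ** F i.
Proof. exact: (lin_sum (plmul_linearr z)). Qed.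

Lemma lie_anti x y : lie x y = - lie y x.
Proof. by rewrite /lie opprB. Qed.

(** The pre-Lie identity in the form used throughout: right multiplications
    form a right action of the commutator Lie algebra. *)
Lemma pm_lie x y z : x ** lie y z = x ** y ** z - x ** z ** y.
Proof.
rewrite /lie pmBr; transitivity (x ** y ** z - x ** z ** y -
  ((x ** y ** z - x ** (y ** z)) - (x ** z ** y - x ** (z ** y)))); first by zmod.
by rewrite plmul_rsym subrr subr0.
Qed.

End PreLieBasics.

Section PointwiseOperations.
Variables (k : fieldType) (T : Type) (V : lmodType k).
Implicit Types f g : T -> V.

Lemma fct0E x : (0 : T -> V) x = 0. Proof. by []. Qed.
Lemma fctDE f g x : (f + g) x = f x + g x. Proof. by []. Qed.
Lemma fctNE f x : (- f) x = - f x. Proof. by []. Qed.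
Lemma fctZE c f x : (c *: f) x = c *: f x. Proof. by []. Qed.

Definition fctE := (fct0E, fctDE, fctNE, fctZE).

End PointwiseOperations.

(** A function g on sequences stands for a family of n-linear symmetric functions,
    one for each n, that is, for a linear functional on the symmetric algebra
    S(E).  [insert x] is dual to the multiplication by x in S(E); [der u d] is
    dual to the derivation extending u, with d acting on the values; [sym_sum] is
    dual to the map S(E) -> E (x) S(E) that singles out one factor in all
    possible ways.  Their commutation rules are those of a Weyl algebra, and
    later computations use only these rules. *)
Section SymmetricFamilies.
Variables (k : fieldType) (E V : lmodType k).
Implicit Types (g : seq E -> V) (u : E -> E) (d : V -> V) (xs ys zs : seq E).

Definition mlin g := forall ys zs, linear (fun x => g (ys ++ x :: zs)).

Definition msym g :=
  forall ys zs x y, g (ys ++ x :: y :: zs) = g (ys ++ y :: x :: zs).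

Definition symml g := mlin g /\ msym g.

Definition insert (x : E) g : seq E -> V := fun xs => g (x :: xs).

Fixpoint der u d g xs : V :=
  if xs is x :: xs' then g (u x :: xs') + der u d (insert x g) xs' else d (g [::]).

Fixpoint sym_sum (F : E -> seq E -> V) xs : V :=
  if xs is x :: xs' then F x xs' + sym_sum (fun y => insert x (F y)) xs' else 0.

Definition only_size n g xs : V := if size xs == n then g xs else 0.

Definition size_div c g xs : V := (size xs + c)%:R^-1 *: g xs.

Lemma insert_lin x : linear (insert x). Proof. by []. Qed.

Lemma insert_linl g : mlin g -> linear (insert^~ g).
Proof. by move=> gL c x y; apply/funext => xs; apply: (gL [::]). Qed.

Lemma insert_der u d x g : insert x (der u d g) = insert (u x) g + der u d (insert x g).
Proof. by []. Qed.

Lemma insert_sym_sum x F : insert x (sym_sum F) = F x + sym_sum (fun y => insert x (F y)).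
Proof. by []. Qed.

Lemma insert_size_div x c g : insert x (size_div c g) = size_div c.+1 (insert x g).
Proof. by apply/funext => xs; rewrite /insert /size_div /= addnS addSn. Qed.

Lemma insert_only_sizeS x n g : insert x (only_size n.+1 g) = only_size n (insert x g).
Proof. by []. Qed.

Lemma insert_only_size0 x g : insert x (only_size 0 g) = 0.
Proof. by []. Qed.

Lemma insert_comm x y g : msym g -> insert x (insert y g) = insert y (insert x g).
Proof. by move=> gS; apply/funext => xs; apply: (gS [::]). Qed.

Lemma symml_insert x g : symml g -> symml (insert x g).
Proof. by case=> gL gS; split=> ys; [apply: (gL (x :: ys)) | apply: (gS (x :: ys))]. Qed.

Lemma symml_subspace : subspace symml.
Proof.
split; first by split=> [ys zs c x y|ys zs x y]; rewrite !fctE ?scaler0 ?addr0.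
move=> c f g [fL fS] [gL gS]; split=> [ys zs a x y|ys zs x y]; rewrite !fctE.
  by rewrite fL gL !scalerDr !scalerA [c * a]mulrC; zmod.
by rewrite fS gS.
Qed.

Lemma only_size_lin n : linear (only_size n).
Proof.
move=> c f g; apply/funext => xs; rewrite !fctE /only_size !fctE.
by case: ifP => // _; rewrite scaler0 addr0.
Qed.

Lemma symml_only_size n g : symml g -> symml (only_size n g).
Proof.
case=> gL gS; split=> [ys zs c x y|ys zs x y]; rewrite /only_size !size_cat /=.
  by case: ifP => _; [apply: gL | rewrite scaler0 addr0].
by rewrite gS.
Qed.

Lemma size_div_lin c : linear (size_div c).
Proof.
move=> a f g; apply/funext => xs; rewrite !fctE /size_div !fctE.
by rewrite scalerDr !scalerA mulrC.
Qed.

Lemma symml_size_div c g : symml g -> symml (size_div c g).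
Proof.
case=> gL gS; split=> [ys zs a x y|ys zs x y]; rewrite /size_div !size_cat /=.
  by rewrite gL scalerDr !scalerA mulrC.
by rewrite gS.
Qed.

Section Der.
Variables (u : E -> E) (d : V -> V).
Hypotheses (uL : linear u) (dL : linear d).

Lemma der_lin : linear (der u d).
Proof.
move=> c f g; apply/funext => xs; elim: xs f g => [|x xs IH] f g.
  by rewrite /= !fctE -dL.
by rewrite !fctE /= insert_lin IH !fctE scalerDr; zmod.
Qed.

Lemma symml_der g : symml g -> symml (der u d g).
Proof.
move=> gM; split.
  move=> ys; elim: ys g gM => [|z ys IH] g gM zs c x y /=.
    have [gL gS] := gM.
    by rewrite uL (gL [::]) (insert_linl gL) der_lin !fctE /= scalerDr; zmod.
  rewrite (gM.1 (u z :: ys)) IH ?scalerDr; first by zmod.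
  exact: symml_insert.
move=> ys; elim: ys g gM => [|z ys IH] g gM zs x y /=.
  have [gL gS] := gM.
  rewrite (gS [::]) insert_comm // addrCA; congr (_ + (_ + _)); exact: (gS [::]).
by rewrite (gM.2 (u z :: ys)) IH //; apply: symml_insert.
Qed.

Lemma der_only_size n g : der u d (only_size n g) = only_size n (der u d g).
Proof.
apply/funext => xs; elim: xs n g => [|x xs IH] [|n] g //=.
- by rewrite /only_size /= (lin0 dL).
- by rewrite insert_only_size0 (lin0 der_lin) /only_size /= addr0.
- by rewrite insert_only_sizeS IH /only_size /= eqSS; case: ifP => // _; rewrite addr0.
Qed.

Lemma der_size_div c g : der u d (size_div c g) = size_div c (der u d g).
Proof.
apply/funext => xs; elim: xs c g => [|x xs IH] c g /=.
  by rewrite /size_div /= (linZ dL).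
by rewrite insert_size_div IH /size_div /= addnS addSn scalerDr.
Qed.

End Der.

Lemma der_linl c (u u1 u2 : E -> E) (d d1 d2 : V -> V) g : mlin g ->
  (forall x, u x = c *: u1 x + u2 x) ->
  (forall xs, d (g xs) = c *: d1 (g xs) + d2 (g xs)) ->
  der u d g = c *: der u1 d1 g + der u2 d2 g.
Proof.
move=> gL uE dE; apply/funext => xs; rewrite !fctE.
elim: xs g gL dE => [|x xs IH] g gL dE /=; first exact: dE.
rewrite IH => [|ys zs|ys]; [|exact: (gL (x :: ys))|exact: dE].
by rewrite uE (gL [::]) /= scalerDr; zmod.
Qed.

Lemma der_comm (u u1 u2 : E -> E) (d d1 d2 : V -> V) g : mlin g ->
  linear d1 -> linear d2 ->
  (forall x, u x = u2 (u1 x) - u1 (u2 x)) ->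
  (forall xs, d (g xs) = d1 (d2 (g xs)) - d2 (d1 (g xs))) ->
  der u d g = der u1 d1 (der u2 d2 g) - der u2 d2 (der u1 d1 g).
Proof.
move=> gL d1L d2L uE dE; apply/funext => xs; rewrite !fctE.
elim: xs g gL dE => [|x xs IH] g gL dE /=; first exact: dE.
rewrite IH => [|ys zs|ys]; [|exact: (gL (x :: ys))|exact: dE].
rewrite uE (linB (gL [::] xs)) /= !insert_der.
rewrite (linD (der_lin u1 d1L)) (linD (der_lin u2 d2L)) !fctE.
by rewrite /insert; zmod.
Qed.

Lemma sym_sum_lin : linear sym_sum.
Proof.
move=> c F G; apply/funext => xs; rewrite !fctE.
elim: xs F G => [|x xs IH] F G /=; first by rewrite scaler0 addr0.
by rewrite -[RHS]/(c *: (_ + _) + (_ + _)) scalerDr addrACA -IH !fctE.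
Qed.

Lemma symml_sym_sum F : linear F -> (forall x, symml (F x)) -> symml (sym_sum F).
Proof.
move=> FL FM; split.
  move=> ys; elim: ys F FL FM => [|z ys IH] F FL FM zs c x y /=.
    rewrite FL !fctE.
    have -> : (fun y0 => insert (c *: x + y) (F y0)) =
        c *: (fun y0 => insert x (F y0)) + (fun y0 => insert y (F y0)).
      by apply/funext => z; rewrite (insert_linl (FM z).1).
    by rewrite sym_sum_lin !fctE scalerDr; zmod.
  rewrite (FM z).1 IH ?scalerDr; first by zmod.
    by move=> a p q; rewrite FL insert_lin.
  by move=> p; apply: symml_insert.
move=> ys; elim: ys F FL FM => [|z ys IH] F FL FM zs x y /=.
  rewrite addrCA; congr (_ + (_ + sym_sum _ zs)).
  by apply/funext => p; apply: insert_comm; case: (FM p).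
rewrite (FM z).2 IH //; first by move=> a p q; rewrite FL insert_lin.
by move=> p; apply: symml_insert.
Qed.

(** The derivation acts either on the factor that is singled out or on the others. *)
Lemma der_sym_sum u d F : linear u -> linear d -> linear F -> (forall x, mlin (F x)) ->
  der u d (sym_sum F) = sym_sum (fun x => der u d (F x) + F (u x)).
Proof.
move=> uL dL FL FM; apply/funext => xs.
elim: xs F FL FM => [|x xs IH] F FL FM; first by rewrite /= (lin0 dL).
rewrite /= insert_sym_sum (linD (der_lin u dL)) !fctE IH.
- rewrite (_ : (fun y => insert x (der u d (F y) + F (u y))) =
    (fun y => insert (u x) (F y)) + (fun y => der u d (insert x (F y)) + insert x (F (u y)))).
    by rewrite !(linD sym_sum_lin) !fctE; zmod.
  by apply/funext => y; rewrite (linD (insert_lin x)) insert_der -addrA.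
- by move=> c p q; rewrite FL insert_lin.
- by move=> y ys; apply: (FM y (x :: ys)).
Qed.

(** Euler's formula for homogeneous polynomials. *)
Lemma sym_sum_insert g xs : msym g -> sym_sum (insert^~ g) xs = (size xs)%:R *: g xs.
Proof.
elim: xs g => [|x xs IH] g gS /=; first by rewrite scale0r.
rewrite (_ : (fun y => insert x (insert y g)) = insert^~ (insert x g)).
  by rewrite IH; [rewrite -[(size xs).+1]addn1 natrD scalerDl scale1r addrC
                 | move=> ys; apply: (gS (x :: ys))].
by apply/funext => y; apply: insert_comm.
Qed.

End SymmetricFamilies.

Arguments insert {k E V} x g xs.

Arguments sym_sum_lin {k E V}.

(** * Graded pre-Lie algebras and first cohomology *)

Section Grading.
Variable k : fieldType.

Definition bilin (U W N : lmodType k) (g : U -> W -> N) :=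
  (forall y, linear (g^~ y)) /\ (forall x, linear (g x)).

Record grading (A : preLieType k) := Grading {
  pr :> nat -> A -> A;
  pr_lin : forall i, linear (pr i);
  pr_pr : forall i j x, pr i (pr j x) = if i == j then pr j x else 0;
  pr_fin : forall x, exists n, x = \sum_(i < n) pr i x;
  pr_mul : forall i j x y, pr i x = x -> pr j y = y -> pr (i + j) (x ** y) = x ** y;
  pr_0 : forall x, pr 0 x = 0
}.

Section Theory.
Variables (A : preLieType k) (gr : grading A).
Implicit Types (x y a s t : A) (N : lmodType k).

Definition hom i x := gr i x = x.

Definition atleast p x := forall i, (i < p)%N -> gr i x = 0.

Lemma hom_pr i x : hom i (gr i x).
Proof. by rewrite /hom pr_pr eqxx. Qed.

Lemma pr_hom i j x : hom i x -> gr j x = if j == i then x else 0.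
Proof. by move=> xi; rewrite -xi pr_pr; case: ifP. Qed.

Lemma hom_mul i j x y : hom i x -> hom j y -> hom (i + j) (x ** y).
Proof. exact: pr_mul. Qed.

Lemma hom_0 x : hom 0 x -> x = 0.
Proof. by move=> <-; apply: pr_0. Qed.

Lemma hom_ind (Q : A -> Prop) : subspace Q ->
  (forall i x, hom i x -> Q x) -> forall x, Q x.
Proof.
move=> Qs QH x; have [n ->] := pr_fin gr x.
by apply: sub_sum => // i _; apply: QH (hom_pr i x).
Qed.

Lemma hom_eq N (f g : A -> N) : linear f -> linear g ->
  (forall i x, hom i x -> f x = g x) -> forall x, f x = g x.
Proof. by move=> fL gL; apply: hom_ind; apply: eq_linear_sub. Qed.

Lemma atleast_sub p : subspace (atleast p).
Proof.
split=> [i _|c x y xp yp i ip]; first exact: lin0 (pr_lin gr i).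
by rewrite pr_lin xp // yp // scaler0 addr0.
Qed.

Lemma atleast0 x : atleast 0 x. Proof. by []. Qed.

Lemma atleast1 x : atleast 1 x. Proof. by case=> // _; apply: pr_0. Qed.

Lemma hom_atleast i p x : (p <= i)%N -> hom i x -> atleast p x.
Proof.
move=> pi xi j jp; rewrite (pr_hom _ xi); case: eqP => // ji.
by move: jp; rewrite ji ltnNge pi.
Qed.

Lemma atleast_ind p (Q : A -> Prop) : subspace Q ->
  (forall i x, (p <= i)%N -> hom i x -> Q x) -> forall x, atleast p x -> Q x.
Proof.
move=> Qs QH x xp; have [n ->] := pr_fin gr x.
apply: sub_sum => // i _; case: (ltnP i p) => ip.
  by rewrite xp //; apply: sub_0.
exact: QH ip (hom_pr i x).
Qed.

Lemma atleast_mul p q x y : atleast p x -> atleast q y -> atleast (p + q) (x ** y).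
Proof.
move=> xp yq; apply: (atleast_ind (Q := fun x => atleast (p + q) (x ** y))) xp.
  split=> [|c a b ap bp]; first by rewrite pm0l; apply: (sub_0 (atleast_sub _)).
  by rewrite plmul_linearl; case: (atleast_sub (p + q)) => _; apply.
move=> i a pi ai; apply: (atleast_ind (Q := fun y => atleast (p + q) (a ** y))) yq.
  split=> [|c s t sp tp]; first by rewrite pm0r; apply: (sub_0 (atleast_sub _)).
  by rewrite plmul_linearr; case: (atleast_sub (p + q)) => _; apply.
by move=> j s qj sj; apply: hom_atleast (hom_mul ai sj); apply: leq_add.
Qed.

Lemma atleast_lie p q x y : atleast p x -> atleast q y -> atleast (p + q) (lie x y).
Proof.
move=> xp yq; apply: (sub_B (atleast_sub (p + q))); first exact: atleast_mul.
by rewrite addnC; apply: atleast_mul.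
Qed.

(** First cohomology with coefficients in Hom(A, N), in degrees at most m. *)
Definition H1vanish m :=
  forall N (g : A -> A -> N), bilin g ->
    (forall a s t, g (a ** s) t - g (a ** t) s = g a (lie s t)) ->
    (forall p q a s, atleast p a -> atleast q s -> (m < p + q)%N -> g a s = 0) ->
  exists h : A -> N, linear h /\ forall a s, g a s = h (a ** s).

Definition prods x := exists a b, x = a ** b.

(** A solution h is determined on the products only.  Composing it with a
    projection onto their span keeps its values in any subspace that contains
    the values of g. *)
Lemma H1vanish_strong m : H1vanish m ->
  forall N (g : A -> A -> N), bilin g ->
    (forall a s t, g (a ** s) t - g (a ** t) s = g a (lie s t)) ->
    (forall p q a s, atleast p a -> atleast q s -> (m < p + q)%N -> g a s = 0) ->
  exists h : A -> N, [/\ linear h, forall a s, g a s = h (a ** s) &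
    forall Q, subspace Q -> (forall a s, Q (g a s)) -> forall x, Q (h x)].
Proof.
move=> Hm N g gB gC gm; have [h [hL hE]] := Hm N g gB gC gm.
have [P [PL Pim Pid]] := projection (span_subspace prods).
exists (fun x => h (P x)); split=> [c x y|a s|Q Qs Qg x].
- by rewrite PL hL.
- by rewrite Pid ?hE //; apply: span_gen; exists a, s.
- apply: (span_sub (Q := fun y => Q (h y))) (Pim x) => [|_ [a [b ->]]]; last by rewrite -hE.
  split=> [|c y z Qy Qz]; first by rewrite (lin0 hL); apply: (sub_0 Qs).
  by rewrite hL; case: Qs => _; apply.
Qed.

(** A right module V over the Lie algebra of A, with a decreasing filtration Bd
    that stops after m and is shifted by the action of elements of high degree.
    For a space of functionals, Bd i v says that v vanishes on arguments of degree
    greater than m - i.  The module laws are required on Bd 0 only: V will be a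
    space of all functions and Bd 0 its subspace of multilinear ones. *)
Record bounded_module m (V : lmodType k) (D : A -> V -> V) (Bd : nat -> V -> Prop) : Prop :=
 BMod {
  bd_sub : forall i, subspace (Bd i);
  bd_anti : forall i j v, (i <= j)%N -> Bd j v -> Bd i v;
  bd_D : forall s, linear (D s);
  bd_lin : forall c s t v, Bd 0 v -> D (c *: s + t) v = c *: D s v + D t v;
  bd_lie : forall s t v, Bd 0 v -> D (lie s t) v = D s (D t v) - D t (D s v);
  bd_atleast : forall i q s v, atleast q s -> Bd i v -> Bd (i + q)%N (D s v);
  bd_0 : forall i v, (m < i)%N -> Bd i v -> v = 0
}.

Section Coefficients.
Variables (m : nat) (V : lmodType k) (D : A -> V -> V) (Bd : nat -> V -> Prop).
Hypothesis VM : bounded_module m D Bd.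

Definition cocycle (F : A -> A -> V) := forall a s t,
  F (a ** s) t - F (a ** t) s - F a (lie s t) + D s (F a t) - D t (F a s) = 0.

Definition bounded2 (F : A -> A -> V) :=
  forall p q a s, atleast p a -> atleast q s -> Bd (p + q)%N (F a s).

Definition bounded1 (G : A -> V) := forall p a, atleast p a -> Bd p (G a).

Section Coboundary.
Variable G : A -> V.
Hypotheses (GL : linear G) (GB : bounded1 G).

Definition coboundary (a s : A) := G (a ** s) + D s (G a).

Lemma coboundary_bilin : bilin coboundary.
Proof.
split=> [s|a] c x y; rewrite /coboundary.
  by rewrite plmul_linearl !GL (bd_D VM) scalerDr; zmod.
by rewrite plmul_linearr GL (bd_lin VM) ?scalerDr; [zmod | apply: GB].
Qed.

Lemma coboundary_bounded : bounded2 coboundary.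
Proof.
move=> p q a s ap sq; apply: (sub_D (bd_sub VM _)); first exact/GB/atleast_mul.
exact/(bd_atleast VM)/GB.
Qed.

Lemma coboundary_cocycle : cocycle coboundary.
Proof.
move=> a s t; rewrite /coboundary pm_lie (linB GL) (bd_lie VM); last exact: GB.
by rewrite (linD (bd_D VM s)) (linD (bd_D VM t)); zmod.
Qed.

End Coboundary.

(** Trivial coefficients suffice: the part of the cocycle identity of lowest total
    degree in the arguments from A does not involve the action on V.  So the
    lowest component of F is a coboundary with trivial coefficients; subtracting
    the coboundary of the solution raises the lowest degree. *)
Lemma H1_coefficients (F : A -> A -> V) : H1vanish m ->
  bilin F -> cocycle F -> bounded2 F ->
  exists G, [/\ linear G, bounded1 G & forall a s, F a s = G (a ** s) + D s (G a)].
Proof.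
move=> Hm FL FC FB.
suff step j : exists G, [/\ linear G, bounded1 G &
    forall p q a s, hom p a -> hom q s -> (0 < q)%N -> (p + q < j)%N ->
      F a s = coboundary G a s].
  have [G [GL GB GE]] := step m.+1; exists G; split=> // a s.
  have [cL1 cL2] := coboundary_bilin GL GB; case: FL => FL1 FL2.
  apply: (hom_eq (FL1 s) (cL1 s)) a => p a ap.
  apply: (hom_eq (FL2 a) (cL2 a)) s => q s sq.
  have [q0|q0] := posnP q.
    have -> : s = 0 by apply: hom_0; rewrite -q0.
    by rewrite (lin0 (FL2 a)) (lin0 (cL2 a)).
  have [pqm|pqm] := ltnP m (p + q); last exact: GE ap sq q0 pqm.
  have B0 (F' : A -> A -> V) : bounded2 F' -> F' a s = 0.
    by move=> F'B; apply: (bd_0 VM) pqm (F'B _ _ _ _ _ _); apply: hom_atleast (leqnn _) _.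
  by rewrite !B0 //; apply: coboundary_bounded.
elim: j => [|j [G [GL GB GE]]].
  exists 0; split=> // [c x y|p a _]; first by rewrite !fctE scaler0 addr0.
  exact: (sub_0 (bd_sub VM _)).
have [cL1 cL2] := coboundary_bilin GL GB.
have cB := coboundary_bounded GB; have cC := coboundary_cocycle GL GB.
case: FL => FL1 FL2; pose F' a s := F a s - coboundary G a s.
have F'L1 s : linear (F'^~ s).
  by move=> c x y; rewrite /F' FL1 cL1 scalerBr; zmod.
have F'L2 a : linear (F' a).
  by move=> c x y; rewrite /F' FL2 cL2 scalerBr; zmod.
have F'B : bounded2 F'.
  by move=> p q a s ap sq; apply: (sub_B (bd_sub VM _)); [apply: FB | apply: cB].
have F'C : cocycle F'.
  move=> a s t; rewrite -[RHS](subrr 0) -{1}(FC a s t) -(cC a s t) /F'.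
  by rewrite (linB (bd_D VM s)) (linB (bd_D VM t)); zmod.
have F'E p q a s : hom p a -> hom q s -> (0 < q)%N -> (p + q < j)%N -> F' a s = 0.
  by move=> ap sq q0 pq; rewrite /F' (GE p q) ?subrr.
(* Above degree m the bounds alone give F' = 0. *)
have [jm|jm] := ltnP m j.
  exists G; split=> // p q a s ap sq q0; rewrite ltnS leq_eqVlt => /orP[/eqP pq|].
    apply/eqP; rewrite -subr_eq0; apply/eqP; apply: (bd_0 VM) jm _.
    by rewrite -pq; apply: F'B; apply: hom_atleast (leqnn _) _.
  exact: GE ap sq q0.
(* The component of F' of total degree j. *)
pose g a s := \sum_(p < j.+1) F' (gr p a) (gr (j - p)%N s).
have gE p q a s : hom p a -> hom q s -> g a s = if (p + q)%N == j then F' a s else 0.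
  move=> ap sq; rewrite /g; case: eqP => [pq|pq].
    have pj : (p < j.+1)%N by rewrite ltnS -pq leq_addr.
    rewrite (bigD1 (Ordinal pj)) //= ap -{1}pq addKn sq big1 ?addr0 // => i ip.
    rewrite (pr_hom _ ap); case: eqP => [E|_]; last exact: lin0 (F'L1 _).
    by case/eqP: ip; apply: val_inj.
  rewrite big1 // => i _; rewrite (pr_hom _ ap) (pr_hom _ sq).
  case: eqP => [ip|_]; last exact: lin0 (F'L1 _).
  case: eqP => [jq|_]; last exact: lin0 (F'L2 _).
  by case: pq; rewrite -ip -jq subnKC // -ltnS.
have gL1 s : linear (g^~ s).
  move=> c x y; rewrite /g scaler_sumr -big_split; apply: eq_bigr => i _ /=.
  by rewrite pr_lin F'L1.
have gL2 a : linear (g a).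
  move=> c x y; rewrite /g scaler_sumr -big_split; apply: eq_bigr => i _ /=.
  by rewrite pr_lin F'L2.
have lL1 (t : A) : linear (fun s => lie s t).
  by move=> c x y; rewrite /lie plmul_linearl plmul_linearr scalerBr; zmod.
have lL2 (t : A) : linear (lie t).
  by move=> c x y; rewrite /lie plmul_linearl plmul_linearr scalerBr; zmod.
have gC a s t : g (a ** s) t - g (a ** t) s = g a (lie s t).
  apply: (hom_eq (f := fun a => g (a ** s) t - g (a ** t) s)
                (g := g^~ (lie s t))) a.
  - by move=> c x y; rewrite !plmul_linearl !gL1 scalerBr; zmod.
  - exact: gL1.
  move=> p a ap; apply: (hom_eq (f := fun s => g (a ** s) t - g (a ** t) s)
                 (g := fun s => g a (lie s t))) s.
  - by move=> c x y; rewrite plmul_linearr gL1 gL2 scalerBr; zmod.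
  - by move=> c x y; rewrite lL1 gL2.
  move=> q s sq; apply: (hom_eq (f := fun t => g (a ** s) t - g (a ** t) s)
                 (g := fun t => g a (lie s t))) t.
  - by move=> c x y; rewrite plmul_linearr gL1 gL2 scalerBr; zmod.
  - by move=> c x y; rewrite lL2 gL2.
  move=> r t rt; rewrite (gE _ _ _ _ (hom_mul ap sq) rt) (gE _ _ _ _ (hom_mul ap rt) sq).
  have st : hom (q + r) (lie s t).
    rewrite /hom /lie (linB (pr_lin gr _)) (hom_mul sq rt) addnC.
    by rewrite (hom_mul rt sq).
  rewrite (gE _ _ _ _ ap st).
  rewrite [(p + r + q)%N]addnAC -addnA; case: eqP => [pqr|_]; last by rewrite subr0.
  have [q0|q0] := posnP q.
    have -> : s = 0 by apply: hom_0; rewrite -q0.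
    by rewrite /lie !(pm0l, pm0r) (lin0 (F'L1 _)) subrr !(lin0 (F'L2 _)) subrr.
  have [r0|r0] := posnP r.
    have -> : t = 0 by apply: hom_0; rewrite -r0.
    by rewrite /lie !(pm0l, pm0r) (lin0 (F'L1 _)) subrr !(lin0 (F'L2 _)) subrr.
  have Z1 : F' a t = 0.
    by apply: (F'E p r) => //; rewrite -pqr ltn_add2l -{1}[r]add0n ltn_add2r.
  have Z2 : F' a s = 0.
    by apply: (F'E p q) => //; rewrite -pqr ltn_add2l -{1}[q]addn0 ltn_add2l.
  apply/eqP; rewrite -subr_eq0 -(F'C a s t) Z1 Z2 !(lin0 (bd_D VM _)); apply/eqP; zmod.
have gm p q a s : atleast p a -> atleast q s -> (m < p + q)%N -> g a s = 0.
  move=> ap sq pqm; rewrite /g big1 // => i _.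
  have [ip|ip] := ltnP i p; first by rewrite ap // (lin0 (F'L1 _)).
  rewrite sq ?(lin0 (F'L2 _)) //; move: (ltn_ord i); rewrite ltnS => ij.
  rewrite -(ltn_add2l i) subnKC //; apply: leq_ltn_trans jm (leq_trans pqm _).
  by rewrite leq_add2r.
have [h [hL hE hQ]] := H1vanish_strong Hm (conj gL1 gL2) gC gm.
have hB x : Bd j (h x).
  apply: hQ; first exact: bd_sub VM _.
  move=> a s; apply: sub_sum; first exact: bd_sub VM _.
  move=> i _; have ij : (i <= j)%N by rewrite -ltnS.
  have := F'B i (j - i)%N (gr i a) (gr (j - i)%N s).
  by rewrite subnKC //; apply; apply: hom_atleast (hom_pr _ _).
exists (fun x => G x + h (gr j x)); split=> [c x y|p a ap|p q a s ap sq q0].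
- by rewrite pr_lin hL GL scalerDr; zmod.
- apply: (sub_D (bd_sub VM _)); first exact: GB.
  have [pj|jp] := leqP p j; first exact: (bd_anti VM) (hB _).
  by rewrite ap // (lin0 hL); apply: (sub_0 (bd_sub VM _)).
rewrite ltnS /coboundary /= => pq; have -> : gr j a = 0.
  rewrite (pr_hom _ ap); case: eqP => // jp.
  by move: pq; rewrite jp -{2}[p]addn0 leq_add2l leqNgt q0.
rewrite (lin0 hL) addr0 (pr_hom _ (hom_mul ap sq)).
rewrite addrAC -/(coboundary G a s); case: eqP => [jpq|jpq].
  by rewrite -hE (gE p q) // -jpq eqxx /F'; zmod.
by rewrite (lin0 hL) addr0 (GE p q) // ltn_neqAle pq andbT eq_sym; apply/eqP.
Qed.

End Coefficients.
End Theory.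
End Grading.

(** * Second cohomology: free pre-Lie algebras are free as Lie algebras *)

Section SecondCohomology.
Variables (k : fieldType) (A : preLieType k) (gr : grading A).
Implicit Types (x y a r s t : A) (xs : seq A).
Local Notation atleast := (atleast gr).

Lemma lieL_lin t : linear (fun s => lie s t).
Proof. by move=> c x y; rewrite /lie plmul_linearl plmul_linearr scalerBr; zmod. Qed.

Lemma lieR_lin t : linear (lie t).
Proof. by move=> c x y; rewrite /lie plmul_linearl plmul_linearr scalerBr; zmod. Qed.

Lemma lie_jacobi r s t : lie (lie r s) t + lie (lie s t) r + lie (lie t r) s = 0.
Proof.
by rewrite /lie -/(lie r s) -/(lie s t) -/(lie t r) !pm_lie /lie !pmBl; zmod.
Qed.

Fixpoint degs (ps : seq nat) xs :=
  match ps, xs with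
  | [::], [::] => True
  | p :: ps', x :: xs' => atleast p x /\ degs ps' xs'
  | _, _ => False
  end.

Lemma degs_nseq p xs : (forall x, atleast p x) -> degs (nseq (size xs) p) xs.
Proof. by move=> H; elim: xs => //= x xs IH. Qed.

Section Families.
Variables (m : nat) (V : lmodType k) (D : A -> V -> V) (Bd : nat -> V -> Prop).
Hypothesis VM : bounded_module gr m D Bd.
Implicit Types (g : seq A -> V).

Definition ders s : (seq A -> V) -> (seq A -> V) := der (plmul^~ s) (D s).

Definition bound i g := forall ps xs, degs ps xs -> Bd (i + sumn ps)%N (g xs).

Definition supp n g := forall xs, (size xs < n)%N -> g xs = 0.

(** The filtration on symmetric families, restricted to those supported on
    sequences of length at least n; the support condition keeps the descent below
    away from length 0, where one would divide by 0. *)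
Definition sym_bounded n i g := [/\ symml g, supp n g & bound i g].

Lemma bound_val g xs : bound 0 g -> Bd 0 (g xs).
Proof.
move=> gB; have := gB _ _ (degs_nseq xs (@atleast0 _ _ gr)).
by apply: (bd_anti VM).
Qed.

Lemma bound_insert i p x g : atleast p x -> bound i g -> bound (i + p) (insert x g).
Proof. by move=> xp gB ps xs H; rewrite -addnA; apply: (gB (p :: ps)). Qed.

Lemma bound_ders i q s g : atleast q s -> bound i g -> bound (i + q) (ders s g).
Proof.
move=> sq gB ps xs; rewrite /ders.
elim: xs ps i g gB => [|x xs IH] [|p ps] i g gB //= => [_|[xp H]].
  by rewrite addnAC; apply: (bd_atleast VM) sq _; apply: (gB [::] [::]).
apply: (sub_D (bd_sub VM _)).
  have := gB (p + q :: ps)%N (x ** s :: xs) (conj (atleast_mul xp sq) H).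
  by rewrite /= [(p + q)%N]addnC -!addnA.
have := IH ps (i + p)%N (insert x g) (bound_insert xp gB) H.
by rewrite -!addnA [(p + (q + _))%N]addnCA.
Qed.

Lemma supp_insert n x g : supp n.+1 g -> supp n (insert x g).
Proof. by move=> gS xs H; apply: gS. Qed.

Lemma supp_ders n s g : supp n g -> supp n (ders s g).
Proof.
move=> gS xs; rewrite /ders; elim: xs n g gS => [|x xs IH] n g gS /= H.
  by rewrite gS // (lin0 (bd_D VM s)).
by rewrite gS // add0r; case: n gS H => // n gS H; apply: (IH n) => //; apply: supp_insert.
Qed.

Lemma sym_bounded_insert n i p x g : atleast p x -> sym_bounded n.+1 i g ->
  sym_bounded n (i + p) (insert x g).
Proof.
move=> xp [gM gS gB]; split; [exact: symml_insert | exact: supp_insert |].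
exact: bound_insert.
Qed.

Lemma plmul_lin s : linear (plmul^~ s : A -> A).
Proof. exact: plmul_linearl. Qed.

Lemma sym_bounded_ders n i q s g : atleast q s -> sym_bounded n i g ->
  sym_bounded n (i + q) (ders s g).
Proof.
move=> sq [gM gS gB]; split; [|exact: supp_ders|exact: bound_ders].
exact: symml_der (plmul_lin s) (bd_D VM s) _ gM.
Qed.

Lemma sym_bounded_sub n i : subspace (sym_bounded n i).
Proof.
split=> [|c f g [fM fS fB] [gM gS gB]]; split.
- exact: sub_0 (symml_subspace _ _).
- by [].
- by move=> ps xs _; apply: (sub_0 (bd_sub VM _)).
- by case: (symml_subspace A V) => _; apply.
- by move=> xs H; rewrite !fctE fS // gS // scaler0 addr0.
- move=> ps xs H; rewrite !fctE; case: (bd_sub VM (i + sumn ps)) => _; apply.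
    exact: fB.
  exact: gB.
Qed.

Lemma families_bounded_module n : bounded_module gr m ders (sym_bounded n).
Proof.
split.
- exact: sym_bounded_sub.
- move=> i j g ij [gM gS gB]; split=> // ps xs H.
  by apply: (bd_anti VM) (gB _ _ H); rewrite leq_add2r.
- by move=> s; apply: der_lin; apply: (bd_D VM).
- move=> c s t g [[gL _] _ gB]; apply: der_linl gL _ _ => [x|xs].
    exact: plmul_linearr.
  by apply: (bd_lin VM); apply: bound_val.
- move=> s t g [[gL _] _ gB]; apply: der_comm gL (bd_D VM s) (bd_D VM t) _ _ => [x|xs].
    exact: pm_lie.
  by apply: (bd_lie VM); apply: bound_val.
- by move=> i q s g; apply: sym_bounded_ders.
- move=> i g im [_ _ gB]; apply/funext => xs; apply: (bd_0 VM) im _.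
  apply: (bd_anti VM) (gB _ _ (degs_nseq xs (@atleast0 _ _ gr))).
  exact: leq_addr.
Qed.

Lemma sym_bounded_size_div n i c g : sym_bounded n i g -> sym_bounded n i (size_div c g).
Proof.
move=> [gM gS gB]; split; first exact: symml_size_div.
  by move=> xs H; rewrite /size_div gS // scaler0.
by move=> ps xs H; apply: (sub_Z (bd_sub VM _)); apply: gB.
Qed.

Lemma sym_bounded_sym_sum n i (F : A -> seq A -> V) : linear F ->
  (forall p x, atleast p x -> sym_bounded n (i + p) (F x)) -> sym_bounded n.+1 i (sym_sum F).
Proof.
move=> FL FB; split.
- by apply: symml_sym_sum FL _ => x; case: (FB _ _ (atleast0 gr x)).
- have : forall x, supp n (F x) by move=> x; case: (FB _ _ (atleast0 gr x)).
  move=> FS xs; elim: xs n F FS {FL FB} => // x xs IH n F FS /= H.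
  rewrite FS // add0r; case: n FS H => // n FS H; apply: (IH n) => // y.
  exact: supp_insert.
have {}FB p x : atleast p x -> bound (i + p) (F x) by move=> /(FB p)[].
move=> ps xs; elim: xs ps i F FB {FL} => [|x xs IH] [|p ps] i F FB //=.
  by move=> _; apply: (sub_0 (bd_sub VM _)).
move=> [xp H]; rewrite addnA; apply: (sub_D (bd_sub VM _)); first exact: FB.
apply: IH H => q y yq; rewrite -addnA [(p + q)%N]addnC addnA.
by apply: bound_insert => //; apply: FB.
Qed.

Definition alternating (T : A -> A -> seq A -> V) := forall s t, T s t = - T t s.

(** A 2-cochain T of the Lie algebra with values in functionals on S(A) is closed
    for two anticommuting differentials: the Koszul one, built from [insert], and
    the Chevalley-Eilenberg one delta, built from [ders]. *)
Definition koszul_closed (T : A -> A -> seq A -> V) := forall r s t,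
  insert r (T s t) + insert s (T t r) + insert t (T r s) = 0.

Definition delta_closed (T : A -> A -> seq A -> V) := forall r s t,
  ders r (T s t) + ders s (T t r) + ders t (T r s)
  - T (lie r s) t - T (lie s t) r - T (lie t r) s = 0.

Hypothesis char0 : [pchar k] =i pred0.
Hypothesis Hm : H1vanish gr m.

Lemma natf_neq0 n : n.+1%:R != 0 :> k.
Proof. by rewrite (proj1 (pcharf0P k) char0). Qed.

(** First cohomology of functionals on S^n(A) for n > 0, n being [size xs].  The
    cocycle f, viewed as a function of one argument a and of the n - 1 others, is
    a coboundary by [H1_coefficients]; symmetrizing the solution over the choice
    of the distinguished argument multiplies by n. *)
Lemma closed_exact n (f : A -> seq A -> V) : linear f ->
  (forall p s, atleast p s -> sym_bounded n.+1 p (f s)) ->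
  (forall s t, ders s (f t) - ders t (f s) - f (lie s t) = 0) ->
  exists g, sym_bounded n.+1 0 g /\ forall s, f s = ders s g.
Proof.
move=> fL fB fC; have WM := families_bounded_module n.
(* f s as a function of one distinguished argument a. *)
pose F a s := insert a (f s).
have FB : bounded2 gr (sym_bounded n) F.
  by move=> p q a s ap sq; rewrite addnC; apply: sym_bounded_insert => //; apply: fB.
have FL : bilin F.
  split=> [s|a] c x y; last by rewrite /F fL insert_lin.
  by case: (fB _ _ (atleast0 gr s)) => -[sL _] _ _; rewrite /F (insert_linl sL).
have FC : cocycle ders F.
  move=> a s t; rewrite -[RHS]/(insert a 0) -[in RHS](fC s t).
  rewrite !(linB (insert_lin a)) /F.
  by rewrite [insert a (ders s _)]insert_der [insert a (ders t _)]insert_der; zmod.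
have [G [GL GB GE]] := H1_coefficients WM Hm FL FC FB.
have hG : sym_bounded n.+1 0 (sym_sum G) by apply: sym_bounded_sym_sum.
exists (size_div 0 (sym_sum G)); split; first exact: sym_bounded_size_div.
move=> s; rewrite /ders (der_size_div _ (bd_D VM s)).
have GM x : mlin (G x) by case: (GB _ _ (atleast0 gr x)) => -[].
rewrite (der_sym_sum (plmul_lin s) (bd_D VM s) GL GM).
have -> : (fun x => der (plmul^~ s) (D s) (G x) + G (x ** s)) = insert^~ (f s).
  by apply/funext => x; rewrite -[RHS]/(F x s) GE addrC.
have [[_ fs] fS _] := fB _ _ (atleast0 gr s).
apply/funext => xs; rewrite /size_div sym_sum_insert // addn0 scalerA.
case: (posnP (size xs)) => [xs0|]; first by rewrite fS ?scaler0 // xs0.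
by case: (size xs) => // l _; rewrite mulVf ?scale1r ?natf_neq0.
Qed.

(** A zigzag between the two differentials.  The Koszul homotopy writes T as the
    Koszul differential of f.  Then delta f is closed for both differentials and
    is supported on longer sequences, so the induction gives g' that corrects f
    to a delta-closed cochain, which [closed_exact] integrates.  The induction
    stops because degrees are positive: functionals on sequences of length at
    least m vanish. *)
Lemma koszul_descent e n (T : A -> A -> seq A -> V) : (m <= n + e)%N ->
  bilin T -> alternating T -> koszul_closed T -> delta_closed T ->
  (forall p q s t, atleast p s -> atleast q t -> sym_bounded n (p + q) (T s t)) ->
  exists g, sym_bounded n.+1 0 g /\
    forall s t, T s t = insert s (ders t g) - insert t (ders s g).
Proof.
elim: e n T => [|e IH] n T mn TL TA TK TD TB.
  exists 0; split; first exact: sub_0 (sym_bounded_sub _ _).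
  move=> s t; rewrite /ders !(lin0 (der_lin _ (bd_D VM _))) !(lin0 (insert_lin _)) subrr.
  apply/funext => xs; have [_ TS TBd] := TB _ _ _ _ (atleast1 gr s) (atleast1 gr t).
  case: (ltnP (size xs) n) => nxs; first by rewrite TS.
  apply: (bd_0 VM) (TBd _ _ (degs_nseq xs (@atleast1 _ _ gr))).
  rewrite sumn_nseq mul1n !addSn add0n; rewrite addn0 in mn.
  by rewrite ltnS; apply: leq_trans mn (leq_trans nxs (leqnSn _)).
have [TL1 TL2] := TL.
(* The Koszul homotopy: on sequences of length l the two terms T s t - T t s and
   the l terms of Euler's formula add up to (l + 2) T s t, and f lives on
   sequences one longer than T. *)
pose f t := size_div 1 (sym_sum (T^~ t)).
have fL : linear f.
  move=> c x y; rewrite /f (_ : T^~ _ = c *: T^~ x + T^~ y) ?sym_sum_lin ?size_div_lin //.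
  by apply/funext => s; rewrite TL2.
have fB p t : atleast p t -> sym_bounded n.+1 p (f t).
  move=> tp; apply: sym_bounded_size_div; apply: sym_bounded_sym_sum (TL1 t) _ => q x xq.
  by rewrite addnC; apply: TB.
have fK s t : insert s (f t) - insert t (f s) = T s t.
  rewrite /f !insert_size_div !insert_sym_sum -(linB (size_div_lin _)).
  rewrite opprD addrACA -(linB sym_sum_lin).
  rewrite (_ : _ - _ = insert^~ (T s t)); last first.
    apply/funext => y; rewrite -[LHS]/(insert s (T y t) - insert t (T y s)).
    by rewrite [T y t]TA (linN (insert_lin s)) -[RHS]subr0 -(TK y s t); zmod.
  rewrite [T t s]TA opprK; apply/funext => xs.
  rewrite /size_div !fctE sym_sum_insert; last first.
    by case: (TB _ _ _ _ (atleast0 gr s) (atleast0 gr t)) => -[].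
  rewrite -mulr2n addrC -scaler_nat -scalerDl -natrD scalerA.
  by rewrite mulVf ?scale1r // addn2 natf_neq0.
have dfB p s q t : atleast p s -> atleast q t -> sym_bounded n.+1 (p + q) (ders s (f t)).
  by move=> sp tq; rewrite addnC; apply: sym_bounded_ders => //; apply: fB.
pose T' s t := ders s (f t) - ders t (f s) - f (lie s t).
have dL s : linear (ders s) by apply: der_lin; apply: (bd_D VM).
have dE r s t : insert r (ders s (f t)) = insert (r ** s) (f t) + ders s (insert r (f t)).
  exact: insert_der.
have insL t : linear (insert^~ (f t)).
  by case: (fB _ _ (atleast0 gr t)) => -[tL _] _ _; apply: insert_linl.
have insert_lie r s t :
    insert (lie r s) (f t) = insert (r ** s) (f t) - insert (s ** r) (f t).
  exact: (linB (insL t)).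
have dlin t : linear (fun s => ders s (f t)).
  move=> c x y; apply: (bd_lin (families_bounded_module n)).
  have [fM fS fb] := fB _ _ (atleast0 gr t); split=> // xs xsn.
  by apply: fS; apply: ltn_trans xsn _.
have dlie r s t : ders (lie r s) (f t) = ders r (ders s (f t)) - ders s (ders r (f t)).
  apply: (bd_lie (families_bounded_module n)).
  have [fM fS fb] := fB _ _ (atleast0 gr t); split=> // xs xsn.
  by apply: fS; apply: ltn_trans xsn _.
have [||||||g' [g'B g'E]] := IH n.+1 T'.
- by rewrite addSnnS.
- split=> [t|s] c x y; rewrite /T'.
    by rewrite dlin fL lieL_lin (dL t) fL !scalerBr; zmod.
  by rewrite dlin fL lieR_lin (dL s) fL !scalerBr; zmod.
- by move=> s t; rewrite /T' [lie s t]lie_anti (linN fL); zmod.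
- move=> r s t; rewrite /T' !(linB (insert_lin _)) !dE.
  rewrite -[RHS]oppr0 -(TD r s t) -!fK !(linB (dL _)) !insert_lie; zmod.
- move=> r s t; rewrite /T' !(linB (dL _)) !dlie.
  have := congr1 f (lie_jacobi r s t); rewrite !(linD fL) (lin0 fL) => J.
  by rewrite -[RHS]J; zmod.
- move=> p q s t sp tq; apply: (sub_B (sym_bounded_sub _ _)); last first.
    by apply: fB; apply: atleast_lie.
  apply: (sub_B (sym_bounded_sub _ _)); first exact: dfB.
  by rewrite addnC; apply: dfB.
have [g'M _ _] := g'B.
(* Adding insert s g' leaves the Koszul differential of f unchanged, since insertions
   commute. *)
pose f' s := f s + insert s g'.
have igL : linear (insert^~ g') by apply: insert_linl; case: g'M.
have [||| g [gB gE]] := @closed_exact n f'.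
- by move=> c x y; rewrite /f' fL igL scalerDr; zmod.
- move=> p s sp; apply: (sub_D (sym_bounded_sub _ _)); first exact: fB.
  by rewrite -[p]add0n; apply: sym_bounded_insert.
- move=> s t; rewrite /f' !(linD (dL _)) (linB igL).
  have E r u : ders r (insert u g') = insert u (ders r g') - insert (u ** r) g'.
    by rewrite [insert u (ders r g')]insert_der; zmod.
  rewrite !E -[RHS](subrr (T' s t)) {2}g'E /T'; zmod.
exists g; split=> // s t; rewrite -!gE /f' !(linD (insert_lin _)) -fK.
by rewrite (insert_comm s t) //; [zmod | case: g'M].
Qed.

(** A 2-cocycle w, extended by zero from the constants to S(A), satisfies the
    hypotheses of [koszul_descent] with n = 0; the linear part of the resulting
    functional is the solution, up to sign. *)
Theorem H2_vanish (w : A -> A -> V) : bilin w ->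
  (forall s t, w s t = - w t s) ->
  (forall r s t, D r (w s t) + D s (w t r) + D t (w r s)
    - w (lie r s) t - w (lie s t) r - w (lie t r) s = 0) ->
  bounded2 gr Bd w ->
  exists h, [/\ linear h, bounded1 gr Bd h &
    forall s t, w s t = D s (h t) - D t (h s) - h (lie s t)].
Proof.
move=> [wL1 wL2] wA wC wB.
pose T s t xs := if xs is [::] then w s t else 0.
have [||||||g [[[gL _] _ gB] gE]] := @koszul_descent m 0 T.
- by [].
- split=> [t|s] c x y; apply/funext => -[|z xs] //=.
  + by rewrite /T wL1.
  + by rewrite !fctE /T scaler0 addr0.
  + by rewrite /T wL2.
  + by rewrite !fctE /T scaler0 addr0.
- by move=> s t; apply/funext => -[|z xs] //=; rewrite !fctE /T ?oppr0.
- by move=> r s t; apply/funext => xs; rewrite !fctE /insert /T !addr0.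
- move=> r s t; apply/funext => -[|z xs]; first by rewrite !fctE /ders /= wC.
  have Z u a b : ders u (T a b) (z :: xs) = 0.
    by rewrite /ders /= (_ : insert z (T a b) = 0) ?(lin0 (der_lin _ (bd_D VM _))) ?addr0.
  by rewrite !fctE !Z /T !subr0 !addr0.
- move=> p q s t sp tq; split=> //.
    split; first by case=> [|? ?] zs c x y; rewrite /T /= scaler0 addr0.
    by case.
  move=> ps [|x xs] H; last exact: sub_0 (bd_sub VM _).
  by case: ps H => //= _; rewrite addn0; apply: wB.
exists (fun s => - g [:: s]); split=> [c x y|p s sp|s t].
- by rewrite (gL [::] [::]) opprD scalerN.
- apply: (sub_N (bd_sub VM _)); have := gB [:: p] [:: s].
  by rewrite /= addn0 add0n; apply.
have := congr1 (@^~ [::]) (gE s t); rewrite /= => ->.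
rewrite !fctE /insert /ders /= /lie (linB (gL [::] [::])) /insert.
by rewrite !(linN (bd_D VM _)); zmod.
Qed.

End Families.
End SecondCohomology.

(** * The Poincare-Birkhoff-Witt theorem *)

Section Derivations.
Variables (k : fieldType) (E V N : lmodType k).

Lemma der_size (u : E -> E) (d : V -> V) (g g' : seq E -> V) xs :
  (forall ys, size ys = size xs -> g ys = g' ys) -> der u d g xs = der u d g' xs.
Proof.
elim: xs g g' => [|x xs IH] g g' H /=; first by rewrite H.
by rewrite H //; congr (_ + _); apply: IH => ys ysz; apply: H; rewrite /= ysz.
Qed.

Lemma der_split (u : E -> E) (d : V -> V) (g : seq E -> V) xs :
  der u d g xs = der u (fun=> 0) g xs + d (g xs).
Proof. by elim: xs g => [|x xs IH] g /=; rewrite ?add0r // IH addrA. Qed.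

Lemma der_comp (u : E -> E) (l : V -> N) (g : seq E -> V) xs : linear l ->
  der u (fun=> 0) (fun ys => l (g ys)) xs = l (der u (fun=> 0) g xs).
Proof.
move=> lL; elim: xs g => [|x xs IH] g /=; first by rewrite (lin0 lL).
by rewrite (linD lL) -IH.
Qed.

End Derivations.

(** L acts on the right on E by rho, and iota embeds L in E.  Then L acts on S(E)
    by p |-> iota s * p + p . s, where . extends rho by derivations.  In the dual of
    S(E), that action sends h to [insert (iota s) h + der_act s h].  Compatible
    prescribed values G for these transforms determine h on the ideal generated by
    iota L; [pbw] says that such an h exists, i.e. that S(E) is a free module over
    the enveloping algebra of L. *)
Section PBW.
Variables (k : fieldType) (L : preLieType k) (E V : lmodType k).
Variables (rho : E -> L -> E) (D : L -> V -> V) (iota : L -> E) (pi : E -> L).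
Hypotheses (rhoB : bilin rho)
  (rho_lie : forall x s t, rho x (lie s t) = rho (rho x s) t - rho (rho x t) s).
Hypotheses (DL : forall s, linear (D s)) (DLs : forall v, linear (D^~ v))
  (D_lie : forall s t v, D (lie s t) v = D s (D t v) - D t (D s v)).
Hypotheses (iotaL : linear iota) (piL : linear pi)
  (iotaK : forall s, pi (iota s) = s)
  (iota_lie : forall s t, iota (lie s t) = rho (iota s) t - rho (iota t) s).
Implicit Types (s t : L) (x y z : E) (g h : seq E -> V) (f : L -> seq E -> V).

(** Given symmetric functions f s with f s (iota t :: xs) symmetric in s and t, [ext]
    builds a symmetric function F with F (iota s :: xs) = f s xs.  Write each
    argument as x = iota (pi x) + x', and expand multilinearly: the first argument
    for which the part in iota L is chosen is fed to f, the earlier ones are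
    replaced by x', and the term with only the x' is put to 0. *)
Fixpoint ext f xs : V :=
  if xs is x :: xs' then f (pi x) xs' + ext (fun s => insert (x - iota (pi x)) (f s)) xs'
  else 0.

Definition extensible f := [/\ linear f, forall s, symml (f s) &
  forall s t, insert (iota s) (f t) = insert (iota t) (f s)].

Lemma extensible_insert z f : extensible f -> extensible (fun s => insert z (f s)).
Proof.
move=> [fL fM fK]; split=> [c s t|s|s t].
- by rewrite fL insert_lin.
- exact: symml_insert.
- by rewrite (insert_comm _ _ (fM t).2) fK (insert_comm _ _ (fM s).2).
Qed.

Lemma ext_lin : linear ext.
Proof.
move=> c f g; apply/funext => xs; rewrite !fctE.
elim: xs f g => [|x xs IH] f g /=; first by rewrite scaler0 addr0.
by rewrite !fctE scalerDr addrACA -IH.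
Qed.

Lemma ext_comp_lin f zs : (forall s, mlin (f s)) ->
  linear (fun z => ext (fun s => insert z (f s)) zs).
Proof.
move=> fM c x y.
rewrite (_ : (fun s => _) = c *: (fun s => insert x (f s)) + fun s => insert y (f s)).
  by rewrite ext_lin !fctE.
by apply/funext => s; rewrite (insert_linl (fM s)).
Qed.

Lemma ext_symml f : extensible f -> symml (ext f).
Proof.
pose r x := x - iota (pi x).
have rL : linear r by move=> c x y; rewrite /r piL iotaL scalerBr; zmod.
move=> fE; split.
  move=> ys; elim: ys f fE => [|z ys IH] f fE zs c x y /=; have [fL fM fK] := fE.
    have H : linear (fun z => ext (fun s => insert z (f s)) zs).
      by apply: ext_comp_lin => s; case: (fM s).
    by rewrite -!/(r _) rL piL fL !fctE H scalerDr; zmod.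
  rewrite (fM _).1 IH; first by rewrite scalerDr; zmod.
  exact: extensible_insert.
move=> ys; elim: ys f fE => [|z ys IH] f fE zs x y /=; have [fL fM fK] := fE.
  rewrite -!/(r _).
  have -> : (fun s => insert (r y) (insert (r x) (f s))) =
            (fun s => insert (r x) (insert (r y) (f s))).
    by apply/funext => s; apply: insert_comm; case: (fM s).
  rewrite !addrA; congr (_ + _); rewrite /insert.
  have E1 a b : f (pi a) (b :: zs) = f (pi a) (iota (pi b) :: zs) + f (pi a) (r b :: zs).
    by rewrite -(linD ((fM _).1 [::] zs)) /= /r addrC subrK.
  rewrite (E1 x y) (E1 y x).
  have := congr1 (@^~ zs) (fK (pi x) (pi y)); rewrite /insert => ->.
  by zmod.
rewrite (fM _).2 IH //; exact: extensible_insert.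
Qed.

Lemma ext_insert f s : extensible f -> insert (iota s) (ext f) = f s.
Proof.
move=> [fL fM fK]; apply/funext => xs; rewrite /insert /= iotaK subrr.
rewrite (lin0 (f := fun z => ext (fun s => insert z (f s)) xs)) ?addr0 //.
by apply: ext_comp_lin => t; case: (fM t).
Qed.

Definition der_act s := der (rho^~ s) (D s).

Variables (G : L -> seq E -> V) (v0 : V).
Hypotheses (GL : linear G) (GM : forall s, symml (G s))
  (GC : forall s t, (insert (iota s) (G t) + der_act s (G t)) -
                    (insert (iota t) (G s) + der_act t (G s)) = G (lie s t)).

(** The component of h on sequences of length n + 1 is forced on those that contain
    an element of iota L by the component of length n. *)
Fixpoint pbw_step n : seq E -> V :=
  if n is n'.+1 then ext (fun s => only_size n' (G s - der_act s (pbw_step n')))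
  else fun xs => if xs is [::] then v0 else 0.

Lemma der_act_lin s : linear (der_act s).
Proof. exact: der_lin. Qed.

Lemma der_act_linl c s t g : mlin g ->
  der_act (c *: s + t) g = c *: der_act s g + der_act t g.
Proof.
move=> gL; apply: der_linl => // [x|xs]; last exact: DLs.
by case: rhoB => _ ->.
Qed.

Lemma symml_der_act s g : symml g -> symml (der_act s g).
Proof. by apply: symml_der => //; case: rhoB. Qed.

Lemma der_act_lie s t g : mlin g ->
  der_act (lie s t) g = der_act s (der_act t g) - der_act t (der_act s g).
Proof. by move=> gL; apply: der_comm. Qed.

(** The functions to be extended satisfy the symmetry required by [ext] because G
    is a cocycle and the action is a Lie action. *)
Lemma pbw_stepP n : symml (pbw_step n) /\
  extensible (fun s => only_size n (G s - der_act s (pbw_step n))).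
Proof.
have LM m : symml (pbw_step m) ->
    linear (fun s => only_size m (G s - der_act s (pbw_step m))) /\
    forall s, symml (only_size m (G s - der_act s (pbw_step m))).
  move=> hM; split=> [c s t|s].
    rewrite GL der_act_linl; last by case: hM.
    by rewrite -only_size_lin; congr only_size; rewrite scalerBr; zmod.
  apply: symml_only_size; apply: (sub_B (symml_subspace E V)) => //; exact: symml_der_act.
elim: n => [|n [hM hE]].
  have h0 : symml (pbw_step 0).
    by split=> [ys zs c x y|ys zs x y]; case: ys => [|? ?]; rewrite /= ?scaler0 ?addr0.
  split=> //; have [fL fM] := LM _ h0; split=> // s t.
have hM1 : symml (pbw_step n.+1) by apply: ext_symml.
split=> //; have [fL fM] := LM _ hM1; split=> // s t.
have h1 r : insert (iota r) (pbw_step n.+1) = only_size n (G r - der_act r (pbw_step n)).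
  exact: ext_insert.
set h := pbw_step n.+1 in hM1 h1 *; set h0 := pbw_step n in hM h1 *.
have only_sizeK g : only_size n (only_size n g) = only_size n g.
  by apply/funext => xs; rewrite /only_size; case: eqP.
have insert_der_act r u : insert (iota r) (der_act u h) =
    insert (rho (iota r) u) h + der_act u (insert (iota r) h) by [].
rewrite !insert_only_sizeS; apply/eqP.
rewrite -subr_eq0 -(linB (@only_size_lin _ _ _ n)); apply/eqP.
pose W := G (lie s t) - der_act s (G t) + der_act t (G s).
suff -> : insert (iota s) (G t - der_act t h) - insert (iota t) (G s - der_act s h) =
    W - only_size n W.
  by rewrite (linB (@only_size_lin _ _ _ n)) only_sizeK subrr.
rewrite !(linB (insert_lin _)) !insert_der_act !h1 /der_act !der_only_size; try exact: DL.
rewrite -!/(der_act _) !(linB (der_act_lin _)).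
have E1 : insert (rho (iota s) t) h - insert (rho (iota t) s) h =
    only_size n (G (lie s t) - der_act (lie s t) h0).
  by rewrite -h1 iota_lie (linB (insert_linl hM1.1)).
have -> : W = insert (iota s) (G t) - insert (iota t) (G s).
  by rewrite /W -GC; zmod.
transitivity (insert (iota s) (G t) - insert (iota t) (G s) -
  ((insert (rho (iota s) t) h - insert (rho (iota t) s) h) +
   (only_size n (der_act t (G s) - der_act t (der_act s h0)) -
    only_size n (der_act s (G t) - der_act s (der_act t h0))))).
  by zmod.
rewrite E1 -(linB (@only_size_lin _ _ _ n)) -(linD (@only_size_lin _ _ _ n)).
congr (_ - only_size n _); rewrite der_act_lie; last by case: hM.
by rewrite -GC; zmod.
Qed.

Theorem pbw : exists h, [/\ symml h, h [::] = v0 &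
  forall s, insert (iota s) h + der_act s h = G s].
Proof.
exists (fun xs => pbw_step (size xs) xs); split=> [|//|s].
  split=> [ys zs c x y|ys zs x y]; rewrite !size_cat /=.
    by case: (pbw_stepP (size ys + (size zs).+1)) => -[gL _] _; apply: gL.
  by case: (pbw_stepP (size ys + (size zs).+2)) => -[_ gS] _; apply: gS.
apply/funext => xs; rewrite !fctE.
have [hM hE] := pbw_stepP (size xs).
have := congr1 (@^~ xs) (ext_insert s hE); rewrite /insert /= => ->.
rewrite /only_size eqxx !fctE /der_act (@der_size _ _ _ _ _ _ (pbw_step (size xs))) ?subrK //.
by move=> ys ->.
Qed.

End PBW.

(** * Cocycles relative to a subalgebra of a free algebra *)

Section Submodules.
Variables (k : fieldType) (V : lmodType k).

Record submodule := Submodule {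
  submodule_set :> set V;
  submodule_subspace : subspace submodule_set
}.

Definition submodule_type (S : submodule) : Type := {x : V | x \in submodule_set S}.

Variable S : submodule.

Lemma submodule_closed : subsemimod_closed (fun x : V => x \in submodule_set S).
Proof.
have [S0 SL] := submodule_subspace S; split; first split.
- exact/mem_set.
- move=> x y /set_mem Sx /set_mem Sy; apply/mem_set.
  exact: sub_D (submodule_subspace S) _ _ _ _.
- by move=> a x /set_mem Sx; apply/mem_set; apply: sub_Z (submodule_subspace S) _ _ _.
Qed.

HB.instance Definition _ := [isSub of submodule_type S for sval].
HB.instance Definition _ := [Choice of submodule_type S by <:].
HB.instance Definition _ :=
  GRing.SubChoice_isSubLmodule.Build k V (fun x : V => x \in submodule_set S)
    (submodule_type S) submodule_closed.

End Submodules.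

(** Functionals on the enveloping algebra of A, as functions on words that respect
    commutators.  [word h] evaluates a functional h on S(A) at the product of a word,
    computed in the model of the enveloping algebra carried by S(A); [rmulT b] is
    dual to the right multiplication by b in that model. *)
Section Words.
Variables (k : fieldType) (A : preLieType k) (N : lmodType k).
Implicit Types (a b c : A) (w : seq A) (F h : seq A -> N).

Definition wlie F := forall u b c w,
  F (u ++ b :: c :: w) - F (u ++ c :: b :: w) = F (u ++ lie b c :: w).

Definition rmulT b h := insert b h + der (plmul^~ b) (fun=> 0) h.

Definition word h w := foldr rmulT h w [::].

Let zeroL : linear ((fun=> 0) : N -> N).
Proof. by move=> c x y; rewrite scaler0 addr0. Qed.

Lemma rmulT_lin b : linear (rmulT b).
Proof. by move=> c f g; rewrite /rmulT insert_lin (der_lin _ zeroL) scalerDr; zmod. Qed.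

Lemma rmulT_linl h : mlin h -> linear (rmulT^~ h).
Proof.
move=> hL c x y; rewrite /rmulT (insert_linl hL).
rewrite (der_linl (c := c) (u1 := plmul^~ x) (d1 := fun=> 0) (u2 := plmul^~ y)
  (d2 := fun=> 0) hL).
- by rewrite scalerDr; zmod.
- by move=> z; apply: plmul_linearr.
- by move=> xs; rewrite scaler0 addr0.
Qed.

Lemma symml_rmulT b h : symml h -> symml (rmulT b h).
Proof.
move=> hM; apply: (sub_D (symml_subspace A N)); first exact: symml_insert.
by apply: symml_der hM => //; apply: plmul_linearl.
Qed.

Lemma rmulT_lie b c h : symml h ->
  rmulT (lie b c) h = rmulT b (rmulT c h) - rmulT c (rmulT b h).
Proof.
move=> hM; rewrite /rmulT (linB (insert_linl hM.1)).
rewrite (der_comm (u := plmul^~ (lie b c)) (d := fun=> 0) hM.1 zeroL zeroL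
   (u1 := plmul^~ b) (u2 := plmul^~ c)).
- rewrite !(linD (insert_lin _)) !(linD (der_lin _ zeroL)) !insert_der.
  by rewrite (insert_comm b c hM.2); zmod.
- by move=> x; apply: pm_lie.
- by move=> xs; rewrite subrr.
Qed.

Lemma symml_foldr h w : symml h -> symml (foldr rmulT h w).
Proof. by move=> hM; elim: w => //= b w IH; apply: symml_rmulT. Qed.

Lemma foldr_rmulT_lin w : linear (foldr rmulT ^~ w : (seq A -> N) -> seq A -> N).
Proof. by elim: w => // b w IH c f g; rewrite /= IH rmulT_lin. Qed.

Lemma word_mlin h : symml h -> mlin (word h).
Proof.
move=> hM u w c x y; rewrite /word !foldr_cat /=.
by rewrite rmulT_linl ?foldr_rmulT_lin //; case: (symml_foldr w hM).
Qed.

Lemma word_wlie h : symml h -> wlie (word h).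
Proof.
move=> hM u b c w; rewrite /word !foldr_cat /= rmulT_lie; last exact: symml_foldr.
by rewrite (linB (foldr_rmulT_lin u)).
Qed.

End Words.

(** Fix a free algebra A and an embedding iota : L -> A of a pre-Lie algebra, with a
    linear retraction pi.  A cocycle g : A x L -> N is shown to be a coboundary by a universal
    property: the pairs (a, F), with F a functional on the enveloping algebra of A
    such that F(w s) = g(a w, s) for s in L, form a pre-Lie algebra for the product
    (a, F)(b, _) = (a b, F(b _)).  Once each generator of A is known to lift to such
    a pair, so does every a, by a morphism a |-> (a, F_a), and h(a) = F_a(1)
    satisfies h(as) = F_a(s) = g(a, s). *)
Section RelativeH1.
Variables (k : fieldType) (A L : preLieType k) (X : Type) (i : X -> A).
Hypothesis Afree : free_on i.
Variables (iota : L -> A) (pi : A -> L).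
Hypotheses (iotaL : linear iota) (iotaM : {morph iota : x y / x ** y})
  (piL : linear pi) (iotaK : forall s, pi (iota s) = s).

(** The symmetric braces a{x_1, ..., x_n} of A, obtained from [pbw] with L = E = A and
    coefficients in A: they solve a{x_1, ..., x_n} b = a{x_1, ..., x_n, b} +
    sum_i a{x_1, ..., x_i b, ..., x_n}. *)
Lemma brace_exists a : exists h : seq A -> A, [/\ symml h, h [::] = a &
  forall b xs, h (b :: xs) + der (plmul^~ b) (fun=> 0) h xs = h xs ** b].
Proof.
have [||||||||||||h [hM h0 hE]] := @pbw k A A A plmul (fun b v => - (v ** b)) id id
    _ _ _ _ _ _ _ _ _ (fun _ => 0) a.
- by split=> ?; [apply: plmul_linearl | apply: plmul_linearr].
- exact: pm_lie.
- by move=> s c x y; rewrite plmul_linearl opprD scalerN.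
- by move=> v c x y; rewrite plmul_linearr opprD scalerN.
- by move=> s t v; rewrite pm_lie !(linN (plmul_linearl _)); zmod.
- by [].
- by [].
- by [].
- by [].
- by move=> c x y; rewrite scaler0 addr0.
- by move=> _; apply: sub_0 (symml_subspace A A).
- move=> s t; rewrite /der_act !(lin0 (insert_lin _)) !(lin0 (der_lin _ _)) ?subrr ?addr0 //.
    by move=> c x y; rewrite plmul_linearl opprD scalerN.
  by move=> c x y; rewrite plmul_linearl opprD scalerN.
exists h; split=> // b xs; have := congr1 (@^~ xs) (hE b).
rewrite !fctE /der_act /insert der_split addrA => /eqP.
by rewrite subr_eq add0r => /eqP.
Qed.

Section Cocycle.
Variables (N : lmodType k) (g : A -> L -> N).
Hypotheses (gB : bilin g)
  (gC : forall a s t, g (a ** iota s) t - g (a ** iota t) s = g a (lie s t)).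

(** [pbw] applied to the functionals x_1 ... x_n |-> g(a{x_1, ..., x_n}, s). *)
Lemma coinduced_exists a : exists F : seq A -> N, [/\ mlin F, wlie F &
  forall w s, F (rcons w (iota s)) = g (foldl plmul a w) s].
Proof.
have [br [brM br0 brE]] := brace_exists a; case: gB => gL1 gL2.
pose G s xs := g (br xs) s.
have derG b s xs : G s (b :: xs) + der (plmul^~ b) (fun=> 0) (G s) xs = g (br xs ** b) s.
  by rewrite (der_comp _ _ _ (gL1 s)) -(linD (gL1 s)) brE.
have iota_lie s t : iota (lie s t) = iota s ** iota t - iota t ** iota s.
  by rewrite (linB iotaL) !iotaM.
have GM s : symml (G s).
  split=> [ys zs c x y|ys zs x y]; rewrite /G.
    by rewrite (brM.1 ys zs) (gL1 s).
  by rewrite (brM.2 ys zs).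
have [||||||||h [hM h0 hE]] := @pbw k L A N (fun x s => x ** iota s) (fun _ _ => 0)
    iota pi _ _ _ _ _ iotaL piL iotaK iota_lie G 0.
- split=> [s|x] c y z; first exact: plmul_linearl.
  by rewrite iotaL plmul_linearr.
- by move=> x s t; rewrite iota_lie -pm_lie.
- by move=> _ c x y; rewrite scaler0 addr0.
- by move=> _ c x y; rewrite scaler0 addr0.
- by move=> *; rewrite subrr.
- by move=> c s t; apply/funext => xs; rewrite /G gL2.
- exact: GM.
- move=> s t; apply/funext => xs; rewrite !fctE /insert /der_act.
  by rewrite !derG gC.
exists (word h); split; [exact: word_mlin | exact: word_wlie | move=> w s].
rewrite /word -cats1 foldr_cat /= [rmulT _ h](hE s).
suff E xs : foldr (@rmulT k A N) (G s) w xs = g (foldl plmul (br xs) w) s by rewrite E br0.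
elim: w xs => [//|b w IH] xs /=.
have -> : foldr (@rmulT k A N) (G s) w = fun ys => g (foldl plmul (br ys) w) s.
  by apply/funext.
pose l v := g (foldl plmul v w) s.
have lL : linear l.
  move=> c x y; rewrite /l (_ : foldl _ _ w = c *: foldl plmul x w + foldl plmul y w).
    exact: gL1.
  by elim: w {IH l} x y => //= z w IH x y; rewrite plmul_linearl IH.
rewrite -/(l _) /rmulT !fctE /insert -[X in der _ _ X](_ : (fun ys => l (br ys)) = _) //.
by rewrite (der_comp _ _ _ lL) -(linD lL) brE.
Qed.

Definition coind_set (p : A * (seq A -> N)) := [/\ mlin p.2, wlie p.2 &
  forall w s, p.2 (rcons w (iota s)) = g (foldl plmul p.1 w) s].

Lemma coind_subspace : subspace coind_set.
Proof.
case: gB => gL1 gL2.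
have fL w : linear (foldl plmul ^~ w : A -> A).
  by elim: w => //= z w IH c x y; rewrite plmul_linearl IH.
split.
  split=> [u w c x y|u b c w|w s]; rewrite /= ?fctE.
  - by rewrite scaler0 addr0.
  - by rewrite subrr.
  - by rewrite (lin0 (fL w)) (lin0 (gL1 s)).
move=> d p q [pL pC pE] [qL qC qE]; split=> [u w c x y|u b c w|w s]; rewrite /= !fctE.
- by rewrite (pL u w) (qL u w) !scalerDr !scalerA [d * c]mulrC; zmod.
- by rewrite -(pC u b c w) -(qC u b c w) scalerBr; zmod.
- by rewrite pE qE (fL w) (gL1 s).
Qed.

Definition coind := Submodule coind_subspace.

Lemma coind_mulP (p q : submodule_type coind) :
  ((val p).1 ** (val q).1, insert (val q).1 (val p).2) \in submodule_set coind.
Proof.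
have [pL pC pE] : coind_set (val p) by apply/set_mem/valP.
apply/mem_set; split=> /= [u w c x y|u b c w|w s].
- exact: (pL (_ :: u) w).
- exact: (pC (_ :: u)).
- by rewrite /insert -rcons_cons pE.
Qed.

Definition coind_mul (p q : submodule_type coind) : submodule_type coind :=
  exist _ ((val p).1 ** (val q).1, insert (val q).1 (val p).2) (coind_mulP p q).

Lemma coind_mul_linearl q : linear (coind_mul^~ q).
Proof.
move=> c p p'; apply: val_inj; rewrite !linearP /=.
by congr (_, _); rewrite /= plmul_linearl.
Qed.

Lemma coind_mul_linearr p : linear (coind_mul p).
Proof.
move=> c q q'; apply: val_inj; rewrite !linearP /=.
have [pL _ _] : coind_set (val p) by apply/set_mem/valP.
by congr (_, _); rewrite /= ?plmul_linearr ?(insert_linl pL).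
Qed.

Lemma coind_mul_rsym p q r :
  coind_mul (coind_mul p q) r - coind_mul p (coind_mul q r) =
  coind_mul (coind_mul p r) q - coind_mul p (coind_mul r q).
Proof.
apply: val_inj; rewrite !linearB /=.
have [pL pC _] : coind_set (val p) by apply/set_mem/valP.
congr (_, _) => /=; first exact: plmul_rsym.
set b := (val q).1; set c := (val r).1; apply/funext => w; rewrite !fctE /insert.
have := pC [::] b c w; rewrite /= /lie (linB (pL [::] w)) /= => H.
apply/eqP; rewrite -subr_eq0; apply/eqP.
transitivity (((val p).2 [:: b, c & w] - (val p).2 [:: c, b & w]) -
  ((val p).2 (b ** c :: w) - (val p).2 (c ** b :: w))); first by zmod.
by rewrite H subrr.
Qed.

Theorem relative_H1 : exists h : A -> N, linear h /\ forall a s, g a s = h (a ** iota s).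
Proof.
pose B : preLieType k := HB.pack (submodule_type coind)
  (Lmodule_isPreLie.Build k (submodule_type coind)
  coind_mul_linearl coind_mul_linearr coind_mul_rsym).
have gen x : exists p : B, (val p).1 = i x.
  have [F FP] := coinduced_exists (i x).
  have Pp : ((i x, F) : A * (seq A -> N)) \in submodule_set coind by apply/mem_set.
  by exists (exist _ (i x, F) Pp).
have [phi [[phiL phiM] phiE _]] := Afree (fun x => projT1 (cid (gen x))).
(* The first component is an endomorphism of A that fixes the generators. *)
have phi1 a : (val (phi a)).1 = a.
  have [psi [_ _ psiU]] := Afree i.
  have := psiU (fun a => (val (phi a)).1) _ _ a; rewrite -(psiU id _ _ a); try by [].
  apply.
  - split=> [c x y|x y]; first by rewrite phiL linearP.
    by rewrite phiM.
  - by move=> x; rewrite phiE; case: cid.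
exists (fun a => (val (phi a)).2 [::]); split=> [c x y|a s].
  by rewrite phiL linearP.
have [_ _ /(_ [::] s) /=] : coind_set (val (phi a)) by apply/set_mem/valP.
by rewrite phi1 phiM /= /insert phi1.
Qed.

End Cocycle.
End RelativeH1.

(** * The grading of a free algebra *)

Section PowerSeries.
Variables (k : fieldType) (A : preLieType k).
Implicit Types (a b c : nat -> A).

Definition conv a b n := \sum_(i < n.+1) a i ** b (n - i)%N.

Lemma conv_linearl b : linear (conv^~ b).
Proof.
move=> c x y; apply/funext => n; rewrite !fctE /conv scaler_sumr -big_split.
by apply: eq_bigr => i _; rewrite !fctE plmul_linearl.
Qed.

Lemma conv_linearr a : linear (conv a).
Proof.
move=> c x y; apply/funext => n; rewrite !fctE /conv scaler_sumr -big_split.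
by apply: eq_bigr => i _; rewrite !fctE plmul_linearr.
Qed.

Lemma conv_convl a b c n : conv (conv a b) c n =
  \sum_(i < n.+1) \sum_(j < (n - i).+1) a i ** b j ** c (n - i - j)%N.
Proof.
rewrite /conv.
transitivity (\sum_(m < n.+1) \sum_(i < n.+1 | (i <= m)%N)
    a i ** b (m - i)%N ** c (n - m)%N).
  apply: eq_bigr => m _; rewrite pm_suml.
  by rewrite (big_ord_widen_cond n.+1 xpredT (fun i => a i ** b (m - i)%N ** c (n - m)%N)).
rewrite (exchange_big_dep xpredT) //=; apply: eq_bigr => i _.
rewrite -(big_mkord (fun m => (i <= m)%N) (fun m => a i ** b (m - i)%N ** c (n - m)%N)).
rewrite (@big_cat_nat _ _ _ i) //=; last by apply: ltnW.
rewrite big_nat_cond big1 => [|m]; last by case: ltnP => // _; rewrite andbF.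
rewrite add0r -{1}[val i]add0n big_addn subSn; last exact: leq_ord.
rewrite big_mkord; apply: eq_big => [j|j _]; first by rewrite leq_addl.
by rewrite addnK subnDAC subnAC.
Qed.

Lemma conv_convr a b c n : conv a (conv b c) n =
  \sum_(i < n.+1) \sum_(j < (n - i).+1) a i ** (b j ** c (n - i - j)%N).
Proof. by apply: eq_bigr => i _; rewrite pm_sumr. Qed.

(** The associator of three series is a sum over i + j + l = n of associators of
    coefficients; exchanging j and l gives the symmetry. *)
Lemma conv_rsym a b c :
  conv (conv a b) c - conv a (conv b c) = conv (conv a c) b - conv a (conv c b).
Proof.
apply/funext => n; rewrite !fctE !conv_convl !conv_convr -!sumrB.
apply: eq_bigr => i _; rewrite -!sumrB [RHS](reindex_inj rev_ord_inj) /=.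
apply: eq_bigr => j _; rewrite subSS subKn; last exact: leq_ord.
exact: plmul_rsym.
Qed.

Definition pseries : Type := nat -> A.
HB.instance Definition _ := GRing.Lmodule.copy pseries (nat -> A).
HB.instance Definition _ := Lmodule_isPreLie.Build k pseries
  conv_linearl conv_linearr conv_rsym.

End PowerSeries.

Section FreeGrading.
Variables (k : fieldType) (A : preLieType k) (X : Type) (i : X -> A).
Hypothesis Afree : free_on i.

(** The subalgebra cut out by Q receives a morphism from A, which composed with the
    inclusion is the identity on generators, hence everywhere. *)
Lemma free_ind (Q : A -> Prop) : subspace Q ->
  (forall x y, Q x -> Q y -> Q (x ** y)) -> (forall x, Q (i x)) -> forall a, Q a.
Proof.
move=> Qs Qm Qi a.
pose S := SubPreLie (subprelie_set := Q) (sub_0 Qs) (sub_D Qs) (sub_Z Qs) Qm.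
have Qin x : i x \in subprelie_set S by apply/mem_set/Qi.
have [phi [[phiL phiM] phiE _]] := Afree (fun x => exist _ (i x) (Qin x) : subprelie_type S).
have [psi [_ _ psiU]] := Afree i.
suff -> : a = val (phi a) by apply/set_mem/valP.
have := psiU (fun a => val (phi a)) _ _ a; rewrite -(psiU id _ _ a) //.
move=> ->//; last by move=> x; rewrite phiE.
by split=> [c x y|x y]; rewrite ?phiL ?linearP ?phiM.
Qed.

(** The morphism from A to power series in one variable t with coefficients in A that
    sends each generator x to x t; the coefficient of t^n is the component of
    degree n. *)
Theorem free_grading : inhabited (grading A).
Proof.
have [phi [[phiL phiM] phiE _]] :=
  Afree (fun x => (fun n : nat => if n == 1%N then i x else 0) : pseries A).
pose p n a := phi a n.
have pL n : linear (p n) by move=> c x y; rewrite /p phiL.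
have pM n x y : p n (x ** y) = \sum_(j < n.+1) p j x ** p (n - j)%N y.
  by rewrite /p phiM.
have pp m n x : p m (p n x) = if m == n then p n x else 0.
  move: x m n; apply: free_ind => [|x y Hx Hy m n|x m n].
  - split=> [m n|c x y Hx Hy m n].
      by rewrite !(lin0 (pL _)); case: ifP.
    by rewrite !pL Hx Hy; case: ifP => // _; rewrite scaler0 addr0.
  - rewrite pM (lin_sum (pL m)).
    have [->|mn] := eqVneq m n.
      apply: eq_bigr => l _; rewrite pM (bigD1 (widen_ord (leqnn _) l)) //= big1.
        by rewrite !Hx !Hy !eqxx addr0.
      move=> r; rewrite -val_eqE /= => rl.
      by rewrite Hx (negbTE rl) pm0l.
    rewrite big1 // => l _; rewrite pM big1 // => r _; rewrite Hx Hy.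
    case: eqP => [rl|_]; last by rewrite pm0l.
    case: eqP => [E|_]; last by rewrite pm0r.
    case/eqP: mn; rewrite -(@subnKC r m) -1?ltnS // E rl subnKC //.
    by rewrite -ltnS.
  - rewrite /p phiE; case: (eqVneq n 1%N) => [->|n1]; first by rewrite phiE.
    by rewrite (lin0 phiL) /=; case: ifP.
have ph m n x : p m x = x -> p n x = if n == m then x else 0.
  by move=> <-; rewrite pp.
have ppM m n x y : p m x = x -> p n y = y -> p (m + n)%N (x ** y) = x ** y.
  move=> xm yn; rewrite pM.
  have mmn : (m < (m + n).+1)%N by rewrite ltnS leq_addr.
  rewrite (bigD1 (Ordinal mmn)) //= addKn xm yn big1 ?addr0 // => l.
  by rewrite -val_eqE /= => lm; rewrite (ph _ _ _ xm) (negbTE lm) pm0l.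
(* Being the sum of the first n components is not stable under addition by itself;
   the vanishing of the later components makes it so. *)
pose Q x := exists n, x = \sum_(j < n) p j x /\ forall j, (n <= j)%N -> p j x = 0.
have Qhom m x : p m x = x -> Q x.
  move=> xm; exists m.+1; rewrite big_ord_recr /= xm big1 ?add0r => [|j _].
    by split=> // j mj; rewrite (ph _ _ _ xm) gtn_eqF.
  by rewrite (ph _ _ _ xm) ltn_eqF.
have Qwiden x n : x = \sum_(j < n) p j x -> (forall j, (n <= j)%N -> p j x = 0) ->
    forall l, (n <= l)%N -> x = \sum_(j < l) p j x.
  move=> xn Hn l nl; rewrite {1}xn (big_ord_widen _ (fun j => p j x) nl) big_mkcond.
  by apply: eq_bigr => j _; case: ltnP => // /Hn->.
have Qs : subspace Q.
  split=> [|c x y [n [xn Hn]] [l [yl Hl]]].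
    by exists 0; rewrite big_ord0; split=> // j _; apply: lin0.
  exists (maxn n l); split=> [|j].
    rewrite {1}(Qwiden _ _ xn Hn (maxn n l)) ?leq_maxl //.
    rewrite {1}(Qwiden _ _ yl Hl (maxn n l)) ?leq_maxr //.
    by rewrite scaler_sumr -big_split; apply: eq_bigr => j _; rewrite pL.
  by rewrite geq_max => /andP[nj lj]; rewrite pL Hn // Hl // scaler0 addr0.
have Qall x : Q x.
  move: x; apply: free_ind => // [x y [n [-> _]] [l [-> _]]|x].
    rewrite pm_suml; apply: sub_sum => // a _; rewrite pm_sumr.
    apply: sub_sum => // b _; apply: (Qhom (a + b)%N).
    by apply: ppM; rewrite pp eqxx.
  by apply: (Qhom 1%N); rewrite /p phiE.
have p_fin x : exists n, x = \sum_(j < n) p j x.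
  by have [n [xn _]] := Qall x; exists n.
have p0 x : p 0 x = 0.
  move: x; apply: free_ind => [|x y Hx Hy|x].
  - by split=> [|c x y Hx Hy]; rewrite ?(lin0 (pL 0)) // pL Hx Hy scaler0 addr0.
  - by rewrite pM big_ord_recl big_ord0 Hx pm0l addr0.
  - by rewrite /p phiE.
by exists; apply: (Grading pL pp p_fin ppM p0).
Qed.

End FreeGrading.

(** * Graded subalgebras of a free algebra *)

Section Induction.
Variables (k : fieldType) (A L : preLieType k) (X : Type) (i : X -> A).
Hypothesis char0 : [pchar k] =i pred0.
Hypothesis Afree : free_on i.
Variables (gA : grading A) (gL : grading L) (iota : L -> A) (pi : A -> L).
Hypotheses (iotaL : linear iota) (iotaM : {morph iota : x y / x ** y})
  (iota_pr : forall j s, iota (gL j s) = gA j (iota s))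
  (piL : linear pi) (iotaK : forall s, pi (iota s) = s)
  (pi_pr : forall j a, pi (gA j a) = gL j (pi a)).
Implicit Types (s t x : L) (a b : A).

Lemma iota_atleast p s : atleast gL p s -> atleast gA p (iota s).
Proof. by move=> sp j jp; rewrite -iota_pr sp // (lin0 iotaL). Qed.

Lemma pi_atleast p a : atleast gA p a -> atleast gL p (pi a).
Proof. by move=> ap j jp; rewrite -pi_pr ap // (lin0 piL). Qed.

Lemma iota_lie s t : iota (lie s t) = lie (iota s) (iota t).
Proof. by rewrite (linB iotaL) !iotaM. Qed.

Section Step.
Variables (m : nat) (N : lmodType k).

Definition coef_act s (v : A -> N) : A -> N := fun a => v (a ** iota s).

(** Hom(A/L, N) as linear maps on A that vanish on L.  The shift by one of the degree
    in A is where positivity of the grading is used: it is what lets degree m control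
    degree m + 1. *)
Definition coef_bd (d : nat) (v : A -> N) :=
  [/\ linear v, forall s, v (iota s) = 0 &
      forall l a, atleast gA l.+1 a -> (m < l + d)%N -> v a = 0].

Lemma coef_bounded_module : bounded_module gL m coef_act coef_bd.
Proof.
split.
- move=> d; split; first by split=> // c x y; rewrite !fctE scaler0 addr0.
  move=> c u v [uL u0 ud] [vL v0 vd]; split=> [e x y|s|l a al H]; rewrite !fctE.
  + by rewrite uL vL !scalerDr !scalerA [c * e]mulrC; zmod.
  + by rewrite u0 v0 scaler0 addr0.
  + by rewrite (ud l) // (vd l) // scaler0 addr0.
- move=> d e v de [vL v0 vd]; split=> // l a al ml; apply: vd al _.
  by apply: leq_trans ml _; rewrite leq_add2l.
- by [].
- move=> c s t v [vL _ _]; apply/funext => a.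
  by rewrite !fctE /coef_act iotaL plmul_linearr vL.
- move=> s t v [vL _ _]; apply/funext => a.
  by rewrite !fctE /coef_act iota_lie pm_lie (linB vL).
- move=> d q s v sq [vL v0 vd]; split=> [c x y|t|l a al H]; rewrite /coef_act.
  + by rewrite plmul_linearl vL.
  + by rewrite -iotaM v0.
  + apply: (vd (l + q)%N); last by rewrite -addnA [(q + d)%N]addnC.
    by rewrite -addSn; apply: atleast_mul => //; apply: iota_atleast.
- move=> d v md [_ _ vd]; apply/funext => a.
  by apply: (vd 0); [apply: atleast1 | rewrite add0n].
Qed.

End Step.

(** g0 extends g along the retraction pi, w measures its failure to be a cocycle on
    A x L, and eta corrects it without changing it on L x L. *)
Lemma H1vanish_succ m : H1vanish gL m -> H1vanish gL m.+1.
Proof.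
move=> Hm N g [gL1 gL2] gC gm.
pose g0 s a := g (pi a) s.
pose w s t a := g0 t (a ** iota s) - g0 s (a ** iota t) - g0 (lie s t) a.
have g0L s : linear (g0 s) by move=> c x y; rewrite /g0 piL gL1.
have wE s t a : w s t a = coef_act s (g0 t) a - coef_act t (g0 s) a - g0 (lie s t) a.
  by [].
have act_lie s t (v : A -> N) a : linear v ->
    coef_act (lie s t) v a = coef_act s (coef_act t v) a - coef_act t (coef_act s v) a.
  by move=> vL; rewrite /coef_act iota_lie pm_lie (linB vL).
have [||||eta [etaL etaB etaE]] := H2_vanish (coef_bounded_module m N) char0 Hm (w := w).
- split=> [t|s] c x y; apply/funext => a; rewrite !fctE /w /g0.
    by rewrite iotaL plmul_linearr piL gL1 gL2 lieL_lin gL2 !scalerBr; zmod.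
  by rewrite iotaL plmul_linearr piL gL1 gL2 lieR_lin gL2 !scalerBr; zmod.
- move=> s t; apply/funext => a; rewrite !fctE /w [lie s t]lie_anti.
  by rewrite /g0 (linN (gL2 _)); zmod.
- move=> r s t; apply/funext => a; rewrite !fctE /coef_act !wE.
  have J : g0 (lie (lie r s) t) a + g0 (lie (lie s t) r) a + g0 (lie (lie t r) s) a = 0.
    by rewrite /g0 -!(linD (gL2 _)) lie_jacobi (lin0 (gL2 _)).
  rewrite -[RHS]J !act_lie; try exact: g0L.
  by rewrite /coef_act; zmod.
- move=> p q s t sp tq; split=> [c x y|x|l a al H]; rewrite /w /g0.
  + by rewrite !plmul_linearl !piL !gL1 !scalerBr; zmod.
  + by rewrite -!iotaM !iotaK -gC; zmod.
  + have pa : atleast gL l.+1 (pi a) by apply: pi_atleast.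
    rewrite (gm (l.+1 + p)%N q) //; first last.
    * by rewrite !addSn ltnS -addnA.
    * by apply: pi_atleast; apply: atleast_mul => //; apply: iota_atleast.
    rewrite (gm (l.+1 + q)%N p) //; first last.
    * by rewrite !addSn ltnS -addnA [(q + p)%N]addnC.
    * by apply: pi_atleast; apply: atleast_mul => //; apply: iota_atleast.
    by rewrite (gm l.+1 (p + q)%N) ?subrr //; apply: atleast_lie.
have etaA s : linear (eta s) by case: (etaB _ _ (atleast0 gL s)).
pose g1 a s := g0 s a - eta s a.
have [||h [hL hE]] := relative_H1 Afree iotaL iotaM piL iotaK (g := g1).
- split=> [s|a] c x y; rewrite /g1 /g0.
    by rewrite piL gL1 etaA scalerBr; zmod.
  by rewrite gL2 etaL !fctE scalerBr; zmod.
- move=> a s t; rewrite /g1.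
  have := congr1 (@^~ a) (etaE s t); rewrite !fctE /w /coef_act => E.
  apply/eqP; rewrite -subr_eq0; apply/eqP.
  transitivity ((g0 t (a ** iota s) - g0 s (a ** iota t) - g0 (lie s t) a) -
    (eta t (a ** iota s) - eta s (a ** iota t) - eta (lie s t) a)); first by zmod.
  by rewrite E subrr.
exists (fun x => h (iota x)); split=> [c x y|a s]; first by rewrite iotaL hL.
have [_ eta0 _] := etaB _ _ (atleast0 gL s).
by rewrite iotaM -hE /g1 /g0 iotaK eta0 subr0.
Qed.

Theorem H1vanish_all m : H1vanish gL m.
Proof.
elim: m => [|m]; last exact: H1vanish_succ.
move=> N g _ _ g0; exists (fun=> 0); split=> [c x y|a s].
  by rewrite scaler0 addr0.
by apply: g0 (atleast1 gL a) (atleast1 gL s) _.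
Qed.

End Induction.

(** * The algebra of leading components of a subalgebra *)

Section AssociatedGraded.
Variables (k : fieldType) (A : preLieType k) (gr : grading A).
Implicit Types (x y : A).

Definition atmost m x := forall j, (m < j)%N -> gr j x = 0.

Lemma atmost_sub m : subspace (atmost m).
Proof.
split=> [i _|c x y xm ym i im]; first exact: lin0 (pr_lin gr i).
by rewrite pr_lin xm // ym // scaler0 addr0.
Qed.

Lemma hom_atmost i m x : (i <= m)%N -> hom gr i x -> atmost m x.
Proof.
move=> im xi j mj; rewrite (pr_hom _ xi) gtn_eqF //.
exact: leq_ltn_trans im mj.
Qed.

Lemma atmost_ind m (Q : A -> Prop) : subspace Q ->
  (forall i x, (i <= m)%N -> hom gr i x -> Q x) -> forall x, atmost m x -> Q x.
Proof.
move=> Qs QH x xm; have [n ->] := pr_fin gr x.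
apply: (sub_sum Qs) => i _; case: (ltnP m i) => im.
  by rewrite xm //; apply: sub_0.
exact: QH im (hom_pr gr i x).
Qed.

Lemma atmost_mono m n x : (m <= n)%N -> atmost m x -> atmost n x.
Proof. by move=> mn xm j nj; apply: xm; apply: leq_ltn_trans mn nj. Qed.

Lemma atmost_ex x : exists m, atmost m x.
Proof.
have [n xn] := pr_fin gr x; exists n => j nj; rewrite xn (lin_sum (pr_lin gr j)).
apply: big1 => i _; rewrite pr_pr gtn_eqF //.
exact: ltn_trans (ltn_ord i) nj.
Qed.

Lemma pr_eq0 x : (forall j, gr j x = 0) -> x = 0.
Proof. by move=> x0; have [n ->] := pr_fin gr x; apply: big1. Qed.

Lemma atmost_pred m x : atmost m.+1 x -> gr m.+1 x = 0 -> atmost m x.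
Proof.
move=> xm x0 j; rewrite leq_eqVlt => /orP[/eqP<-|]; [exact: x0 | exact: xm].
Qed.

Lemma atmost_0 x : atmost 0 x -> x = 0.
Proof. by move=> x0; apply: pr_eq0 => -[|j]; [apply: pr_0 | apply: x0]. Qed.

Lemma atmost_mul p q x y : atmost p x -> atmost q y -> atmost (p + q) (x ** y).
Proof.
move=> xp yq; apply: (atmost_ind (Q := fun x => atmost (p + q) (x ** y))) xp.
  split=> [|c a b ap bp]; first by rewrite pm0l; apply: sub_0 (atmost_sub _).
  by rewrite plmul_linearl; case: (atmost_sub (p + q)) => _; apply.
move=> i a pi ai; apply: (atmost_ind (Q := fun y => atmost (p + q) (a ** y))) yq.
  split=> [|c s t sp tp]; first by rewrite pm0r; apply: sub_0 (atmost_sub _).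
  by rewrite plmul_linearr; case: (atmost_sub (p + q)) => _; apply.
by move=> j s qj sj; apply: hom_atmost (hom_mul ai sj); apply: leq_add.
Qed.

Lemma atmost_lead p q x y : atmost p x -> atmost q y ->
  gr (p + q)%N (x ** y) = gr p x ** gr q y.
Proof.
move=> xp yq.
apply: (atmost_ind (Q := fun x => gr (p + q)%N (x ** y) = gr p x ** gr q y)) xp.
  apply: eq_linear_sub => c a b; first by rewrite plmul_linearl pr_lin.
  by rewrite pr_lin plmul_linearl.
move=> i a ip ai.
apply: (atmost_ind (Q := fun y => gr (p + q)%N (a ** y) = gr p a ** gr q y)) yq.
  apply: eq_linear_sub => c s t; first by rewrite plmul_linearr pr_lin.
  by rewrite pr_lin plmul_linearr.
move=> j s jq sj; rewrite (pr_hom _ (hom_mul ai sj)) (pr_hom _ ai) (pr_hom _ sj).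
have [->|pi] := eqVneq p i.
  rewrite eqn_add2l; case: eqP => // _; by rewrite pm0r.
rewrite pm0l gtn_eqF // -addSn leq_add //.
by rewrite ltn_neqAle eq_sym pi ip.
Qed.

Variable S : subPreLie A.

Definition gr_lead m x := exists s, [/\ subprelie_set S s, atmost m s & gr m s = gr m x].

Definition gr_set x := forall m, gr_lead m x.

Lemma gr_lead_sub m : subspace (gr_lead m).
Proof.
split; first by exists 0; split; [apply: subprelie0 | apply: sub_0 (atmost_sub _) |].
move=> c x y [s [Ss sm sE]] [t [St tm tE]]; exists (c *: s + t); split.
- by apply: subprelieD => //; apply: subprelieZ.
- by case: (atmost_sub m) => _; apply.
- by rewrite !pr_lin sE tE.
Qed.

Lemma gr_lead0 m x : gr m x = 0 -> gr_lead m x.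
Proof.
move=> x0; exists 0; split; [exact: subprelie0 | exact: sub_0 (atmost_sub _) |].
by rewrite x0 (lin0 (pr_lin gr m)).
Qed.

Lemma gr_set_sub : subspace gr_set.
Proof.
split=> [m|c x y xT yT m]; first exact: sub_0 (gr_lead_sub m).
by case: (gr_lead_sub m) => _; apply.
Qed.

Lemma gr_setM x y : gr_set x -> gr_set y -> gr_set (x ** y).
Proof.
move=> xT yT m; have [n xn] := pr_fin gr x; have [l yl] := pr_fin gr y.
rewrite {1}xn pm_suml; apply: (sub_sum (gr_lead_sub m)) => i _.
rewrite yl pm_sumr; apply: (sub_sum (gr_lead_sub m)) => j _.
have hxy := hom_mul (hom_pr gr i x) (hom_pr gr j y).
have [ijm|ijm] := eqVneq m (i + j)%N; last first.
  by apply: gr_lead0; rewrite (pr_hom _ hxy) (negbTE ijm).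
have [s [Ss si sE]] := xT i; have [t [St tj tE]] := yT j.
exists (s ** t); rewrite ijm hxy; split; first exact: subprelieM.
  exact: atmost_mul.
by rewrite atmost_lead // sE tE.
Qed.

Definition grS : subPreLie A :=
  SubPreLie (sub_0 gr_set_sub) (sub_D gr_set_sub) (sub_Z gr_set_sub) gr_setM.

Lemma grS_pr j x : gr_set x -> gr_set (gr j x).
Proof.
move=> xT m; have [->|mj] := eqVneq m j.
  by have [s [Ss sj sE]] := xT j; exists s; split=> //; rewrite sE hom_pr.
by apply: gr_lead0; rewrite pr_pr (negbTE mj).
Qed.

Lemma grS_lead m s : subprelie_set S s -> atmost m s -> gr_set (gr m s).
Proof.
move=> Ss sm j; have [->|jm] := eqVneq j m.
  by exists s; split=> //; rewrite hom_pr.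
by apply: gr_lead0; rewrite pr_pr (negbTE jm).
Qed.

Local Notation L := (subprelie_type grS).

Lemma grS_inP (x : L) j : gr j (val x) \in subprelie_set grS.
Proof. by apply/mem_set/grS_pr/set_mem/valP. Qed.

Definition grL j (x : L) : L := exist _ (gr j (val x)) (grS_inP x j).

Lemma grL_lin j : linear (grL j).
Proof. by move=> c x y; apply: val_inj; rewrite !linearP /= pr_lin. Qed.

Lemma grL_pr i j (x : L) : grL i (grL j x) = if i == j then grL j x else 0.
Proof. by apply: val_inj; rewrite [LHS]/= pr_pr; case: ifP. Qed.

Lemma grL_fin (x : L) : exists n, x = \sum_(i < n) grL i x.
Proof.
have [n xn] := pr_fin gr (val x); exists n; apply: val_inj.
by rewrite linear_sum.
Qed.

Lemma grL_mul i j (x y : L) : grL i x = x -> grL j y = y -> grL (i + j) (x ** y) = x ** y.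
Proof.
move=> /(congr1 val) xi /(congr1 val) yj; apply: val_inj => /=.
exact: pr_mul.
Qed.

Lemma grL_0 (x : L) : grL 0 x = 0.
Proof. by apply: val_inj; apply: pr_0. Qed.

Definition grL_grading : grading L := Grading grL_lin grL_pr grL_fin grL_mul grL_0.

(** Any projection becomes graded when replaced by the sum of its diagonal components. *)
Lemma graded_retraction : exists pi : A -> L, [/\ linear pi, forall x : L, pi (val x) = x &
  forall j a, pi (gr j a) = grL_grading j (pi a)].
Proof.
have [P [PL PT Pid]] := projection gr_set_sub.
have [|||pi [piL piE]] := @linear_selection k A L (fun a t =>
    forall j, gr j (val t) = gr j (P (gr j a))).
- by move=> j; rewrite !(lin0 (pr_lin gr j)) (lin0 PL) (lin0 (pr_lin gr j)).
- by move=> c x y v w xv yw j; rewrite linearP !pr_lin PL pr_lin xv yw.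
- move=> a; have [n an] := atmost_ex a.
  pose t := \sum_(j < n.+1) gr j (P (gr j a)).
  have tT : t \in subprelie_set grS.
    by apply/mem_set/(sub_sum gr_set_sub) => j _; apply: grS_pr.
  exists (exist _ t tT) => j; rewrite /= (lin_sum (pr_lin gr j)).
  have [jn|nj] := ltnP j n.+1.
    rewrite (bigD1 (Ordinal jn)) //= pr_pr eqxx big1 ?addr0 // => l.
    by rewrite pr_pr -val_eqE eq_sym /= => /negbTE->.
  rewrite big1 => [|l _]; last by rewrite pr_pr gtn_eqF // (leq_trans _ nj).
  by rewrite an // (lin0 PL) (lin0 (pr_lin gr j)).
have eqL (x y : L) : (forall j, gr j (val x) = gr j (val y)) -> x = y.
  move=> xy; apply: val_inj; apply/eqP; rewrite -subr_eq0; apply/eqP; apply: pr_eq0 => j.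
  by rewrite (linB (pr_lin gr j)) xy subrr.
exists pi; split=> // [x|j a]; apply: eqL => l; rewrite piE.
  rewrite Pid ?hom_pr //; apply/set_mem; exact: grS_inP.
rewrite pr_pr /= pr_pr; case: eqP => [->|_]; first by rewrite piE.
by rewrite (lin0 PL) (lin0 (pr_lin gr l)).
Qed.

End AssociatedGraded.

(** * Lifting free generators *)

Section Lifting.
Variables (k : fieldType) (A : preLieType k) (gr : grading A) (S : subPreLie A).
Local Notation T := (subprelie_type S).
Local Notation L := (subprelie_type (grS gr S)).
Local Notation gL := (grL_grading gr S).
Hypothesis H1 : forall m, H1vanish gL m.
Implicit Types (a b c s : T) (x y z : L).

Definition leS m s := atmost gr m (val s).

Lemma leS_mul p q a b : leS p a -> leS q b -> leS (p + q) (a ** b).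
Proof. by move=> pa qb; apply: atmost_mul. Qed.

Lemma leS_sub m : subspace (leS m).
Proof.
split=> [|c x y xm ym]; rewrite /leS ?linearP /=; first exact: sub_0 (atmost_sub _ _).
by case: (atmost_sub gr m) => _; apply.
Qed.

Lemma leS_0 s : leS 0 s -> s = 0.
Proof. by move=> s0; apply: val_inj; apply: atmost_0 s0. Qed.

Lemma lift_exists m : exists lifting : L -> T, linear lifting /\
  forall x, leS m (lifting x) /\ gr m (val (lifting x)) = gr m (val x).
Proof.
apply: (linear_selection (R := fun x s => leS m s /\ gr m (val s) = gr m (val x))).
- by split; first exact: sub_0 (leS_sub _).
- move=> c x y v w [vm vE] [wm wE]; split; first by case: (leS_sub m) => _; apply.
  by rewrite !linearP !pr_lin vE wE.
move=> x; have /(_ m) [s [Ss sm sE]] : gr_set gr S (val x) by apply/set_mem/valP.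
by exists (exist _ s (mem_set Ss)).
Qed.

Definition lifting m : L -> T := projT1 (cid (lift_exists m)).

Lemma lifting_lin m : linear (lifting m).
Proof. by rewrite /lifting; case: cid => ? []. Qed.

Lemma lifting_atmost m x : leS m (lifting m x).
Proof. by rewrite /lifting; case: cid => h [hL hH] /=; case: (hH x). Qed.

Arguments lifting_atmost : clear implicits.

Lemma lifting_lead m x : gr m (val (lifting m x)) = gr m (val x).
Proof. by rewrite /lifting; case: cid => h [hL hH] /=; case: (hH x). Qed.

Definition retraction : A -> L := projT1 (cid (graded_retraction gr S)).

Lemma retraction_lin : linear retraction.
Proof. by rewrite /retraction; case: cid => ? []. Qed.

Lemma retraction_val x : retraction (val x) = x.
Proof. by rewrite /retraction; case: cid => ? []. Qed.

Lemma retraction_pr j (a : A) : retraction (gr j a) = gL j (retraction a).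
Proof. by rewrite /retraction; case: cid => ? []. Qed.

Definition lead m s : L := retraction (gr m (val s)).

Lemma lead_lin m : linear (lead m).
Proof. by move=> c x y; rewrite /lead linearP pr_lin retraction_lin. Qed.

Lemma val_lead m s : leS m s -> val (lead m s) = gr m (val s).
Proof.
move=> sm; have lT : gr m (val s) \in subprelie_set (grS gr S).
  by apply/mem_set/grS_lead => //; apply/set_mem/valP.
by rewrite /lead -[gr m _]/(val (exist _ (gr m (val s)) lT : L)) retraction_val.
Qed.

Lemma lead_hom m s : hom gL m (lead m s).
Proof. by rewrite /hom /lead -retraction_pr hom_pr. Qed.

Lemma lead_lifting m x : lead m (lifting m x) = gL m x.
Proof. by rewrite /lead lifting_lead retraction_pr retraction_val. Qed.

Lemma lead0 m s : leS m.+1 s -> lead m.+1 s = 0 -> leS m s.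
Proof. by move=> sm s0; apply: atmost_pred => //; rewrite -val_lead // s0. Qed.

Lemma lead_atmost m n s : leS m s -> (m < n)%N -> lead n s = 0.
Proof. by move=> sm mn; rewrite /lead sm // (lin0 retraction_lin). Qed.

Lemma lead_mul p q a b : leS p a -> leS q b ->
  lead (p + q)%N (a ** b) = lead p a ** lead q b.
Proof.
move=> pa qb; apply: val_inj; rewrite val_plmul !val_lead //; last exact: leS_mul.
exact: atmost_lead.
Qed.

Definition decomposable m x := span (@prods k L) (gL m x).

Lemma decomposable_sub m : subspace (decomposable m).
Proof.
split=> [|c x y xm ym]; rewrite /decomposable.
  by rewrite (lin0 (pr_lin gL m)); apply: span0.
by rewrite pr_lin; case: (span_subspace (@prods k L)) => _; apply.
Qed.

(** A basis, in degree m + 1, of a complement of the products. *)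
Definition new_gens m : L -> Prop := projT1 (cid (basis (decomposable_sub m.+1))).

Lemma new_gens_span m x : span (fun y => decomposable m.+1 y \/ new_gens m y) x.
Proof. by rewrite /new_gens; case: cid => X []. Qed.

Lemma new_gens_ext m (N : lmodType k) (f : L -> N) : exists h : L -> N,
  [/\ linear h, forall x, decomposable m.+1 x -> h x = 0 &
      forall x, new_gens m x -> h x = f x].
Proof. by rewrite /new_gens; case: cid => X [_ H] /=; apply: H. Qed.

Definition generator : Type := {m : nat & {x : L | new_gens m x}}.

Definition generator_val (g : generator) : T := lifting (tag g).+1 (sval (tagged g)).

Section Extension.
Variables (B : preLieType k) (f : generator -> B).

(** Multiplicativity is asked only when the degrees of the factors add up to at most m;
    phi itself is defined on the whole of S. *)
Record partial_morphism m (phi : T -> B) : Prop := PartialMorphism {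
  pm_lin : linear phi;
  pm_mul : forall p q a b, leS p a -> leS q b -> (p + q <= m)%N ->
    phi (a ** b) = phi a ** phi b;
  pm_gen : forall j (g : {x : L | new_gens j x}), (j < m)%N ->
    phi (generator_val (Tagged _ g)) = f (Tagged _ g)
}.

(** The failure of phi to be multiplicative in degree m + 1 depends only on the leading
    components of the factors.  It therefore defines a cochain on gr S, which is a
    cocycle because S and B both satisfy the pre-Lie identity. *)
Section Defect.
Variables (m : nat) (phi : T -> B).
Hypothesis phiP : partial_morphism m phi.
Let phiL := pm_lin phiP.

Definition defect a b := phi a ** phi b - phi (a ** b).

Lemma defect_bilin : bilin defect.
Proof.
by split=> [a|a] c x y; rewrite /defect phiL ?plmul_linearl ?plmul_linearr phiL
  scalerBr; zmod.
Qed.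

Lemma defect0 p q a b : leS p a -> leS q b -> (p + q <= m)%N -> defect a b = 0.
Proof. by move=> pa qb pqm; rewrite /defect (pm_mul phiP pa qb pqm) subrr. Qed.

Lemma defect_leadl p q a b : leS p a -> leS q b -> (p + q = m.+1)%N ->
  lead p a = 0 -> defect a b = 0.
Proof.
case: p => [|p] pa qb pqm p0.
  by rewrite (leS_0 pa) (lin0 (defect_bilin.1 b)).
apply: (defect0 (lead0 pa p0) qb); move: pqm; rewrite addSn => -[->].
exact: leqnn.
Qed.

Lemma defect_leadr p q a b : leS p a -> leS q b -> (p + q = m.+1)%N ->
  lead q b = 0 -> defect a b = 0.
Proof.
case: q => [|q] pa qb pqm q0.
  by rewrite (leS_0 qb) (lin0 (defect_bilin.2 a)).
apply: (defect0 pa (lead0 qb q0)); move: pqm; rewrite addnS => -[->].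
exact: leqnn.
Qed.

Definition graded_defect x y := \sum_(p < m.+2) defect (lifting p x) (lifting (m.+1 - p)%N y).

Lemma graded_defect_bilin : bilin graded_defect.
Proof.
have [dL1 dL2] := defect_bilin.
by split=> z c x y; rewrite /graded_defect scaler_sumr -big_split; apply: eq_bigr => p _;
  rewrite lifting_lin ?dL1 ?dL2.
Qed.

Lemma graded_defect_term p x y : (p <= m.+1)%N ->
  gL p x = 0 \/ gL (m.+1 - p)%N y = 0 -> defect (lifting p x) (lifting (m.+1 - p)%N y) = 0.
Proof.
move=> pm [x0|y0].
  apply: (defect_leadl (lifting_atmost p x) (lifting_atmost _ y)); first by rewrite subnKC.
  by rewrite lead_lifting.
apply: (defect_leadr (lifting_atmost p x) (lifting_atmost _ y)); first by rewrite subnKC.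
by rewrite lead_lifting.
Qed.

Lemma graded_defect_hom p q x y : hom gL p x -> hom gL q y ->
  graded_defect x y = if (p + q == m.+1)%N then defect (lifting p x) (lifting q y) else 0.
Proof.
move=> xp yq; rewrite /graded_defect; case: eqP => [pqm|pqm].
  have pm : (p < m.+2)%N by rewrite ltnS -pqm leq_addr.
  rewrite (bigD1 (Ordinal pm)) //= big1 ?addr0 => [|r].
    by rewrite -{1}pqm addKn.
  rewrite -val_eqE /= => rp; apply: graded_defect_term; first exact: leq_ord.
  by left; rewrite (pr_hom _ xp) (negbTE rp).
rewrite big1 // => r _; apply: graded_defect_term; first exact: leq_ord.
rewrite (pr_hom _ xp) (pr_hom _ yq); case: eqP => [rp|_]; last by left.
case: eqP => [E|_]; last by right.
by case: pqm; rewrite -rp -E subnKC //; apply: leq_ord.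
Qed.

Lemma graded_defect_lead p q a b : leS p a -> leS q b -> (p + q = m.+1)%N ->
  graded_defect (lead p a) (lead q b) = defect a b.
Proof.
move=> pa qb pqm; rewrite (graded_defect_hom (lead_hom _ _) (lead_hom _ _)) pqm eqxx.
have [dL1 dL2] := defect_bilin.
have sub_lead n c : leS n c -> leS n (lifting n (lead n c) - c) /\
    lead n (lifting n (lead n c) - c) = 0.
  move=> nc; split; first exact: (sub_B (leS_sub n) (lifting_atmost _ _) nc).
  by rewrite (linB (lead_lin n)) lead_lifting lead_hom subrr.
have [a1 a2] := sub_lead _ _ pa; have [b1 b2] := sub_lead _ _ qb.
transitivity (defect a (lifting q (lead q b))).
  apply/eqP; rewrite -subr_eq0 -(linB (dL1 _)); apply/eqP.
  exact: (defect_leadl a1 (lifting_atmost _ _) pqm).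
apply/eqP; rewrite -subr_eq0 -(linB (dL2 _)); apply/eqP.
exact: (defect_leadr pa b1 pqm).
Qed.

Lemma graded_defect_cocycle x y z :
  graded_defect (x ** y) z - graded_defect (x ** z) y = graded_defect x (lie y z).
Proof.
have [gL1 gL2] := graded_defect_bilin.
apply: (hom_eq (gr := gL) (f := fun x => graded_defect (x ** y) z - graded_defect (x ** z) y)
  (g := graded_defect^~ (lie y z))) x.
- by move=> c x x'; rewrite !plmul_linearl !gL1 scalerBr; zmod.
- exact: gL1.
move=> p x xp; apply: (hom_eq (gr := gL)
  (f := fun y => graded_defect (x ** y) z - graded_defect (x ** z) y)
  (g := fun y => graded_defect x (lie y z))) y.
- by move=> c y y'; rewrite plmul_linearr gL1 gL2 scalerBr; zmod.
- by move=> c y y'; rewrite lieL_lin gL2.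
move=> q y yq; apply: (hom_eq (gr := gL)
  (f := fun z => graded_defect (x ** y) z - graded_defect (x ** z) y)
  (g := fun z => graded_defect x (lie y z))) z.
- by move=> c z z'; rewrite plmul_linearr gL1 gL2 scalerBr; zmod.
- by move=> c z z'; rewrite lieR_lin gL2.
move=> r z zr.
have [p0|p0] := posnP p.
  have -> : x = 0 by apply: (@hom_0 _ _ gL); rewrite -p0.
  by rewrite !pm0l !(lin0 (gL1 _)) subrr.
have [q0|q0] := posnP q.
  have -> : y = 0 by apply: (@hom_0 _ _ gL); rewrite -q0.
  by rewrite /lie !(pm0l, pm0r) (lin0 (gL1 _)) subrr !(lin0 (gL2 _)) subrr.
have [r0|r0] := posnP r.
  have -> : z = 0 by apply: (@hom_0 _ _ gL); rewrite -r0.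
  by rewrite /lie !(pm0l, pm0r) (lin0 (gL1 _)) subrr !(lin0 (gL2 _)) subrr.
have yz := hom_mul yq zr; have zy := hom_mul zr yq.
rewrite (linB (gL2 x)) -/(lie y z).
have [pqr|pqr] := eqVneq (p + q + r)%N m.+1; last first.
  rewrite (graded_defect_hom (hom_mul xp yq) zr) (graded_defect_hom (hom_mul xp zr) yq).
  rewrite (graded_defect_hom xp yz) (graded_defect_hom xp zy).
  by rewrite [(r + q)%N]addnC addnA [(p + r + q)%N]addnAC (negbTE pqr) subrr.
pose a := lifting p x; pose b := lifting q y; pose c := lifting r z.
have [pa qb rc] : [/\ leS p a, leS q b & leS r c] by split; apply: lifting_atmost.
have [ax bY cz] : [/\ lead p a = x, lead q b = y & lead r c = z].
  by rewrite !lead_lifting; split.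
have prq : (p + r + q = m.+1)%N by rewrite addnAC.
have -> : graded_defect (x ** y) z = defect (a ** b) c.
  by rewrite -(graded_defect_lead (leS_mul pa qb) rc) // lead_mul // ax bY cz.
have -> : graded_defect (x ** z) y = defect (a ** c) b.
  by rewrite -(graded_defect_lead (leS_mul pa rc) qb) // lead_mul // ax bY cz.
have -> : graded_defect x (y ** z) = defect a (b ** c).
  by rewrite -(graded_defect_lead pa (leS_mul qb rc)) ?addnA // lead_mul // ax bY cz.
have -> : graded_defect x (z ** y) = defect a (c ** b).
  by rewrite -(graded_defect_lead pa (leS_mul rc qb)) ?addnA // lead_mul // ax bY cz.
have small u v w : (u + v + w = m.+1)%N -> (0 < w)%N -> (u + v <= m)%N.
  by move=> E w0; rewrite -ltnS -E -[X in (X < _)%N]addn0 ltn_add2l.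
have pqm := small _ _ _ pqr r0; have prm := small _ _ _ prq q0.
have qrm : (q + r <= m)%N by apply: (small _ _ p) p0; rewrite addnC addnA.
rewrite /defect (pm_mul phiP pa qb pqm) (pm_mul phiP pa rc prm).
rewrite (pm_mul phiP qb rc qrm) (pm_mul phiP rc qb); last by rewrite addnC.
have := congr1 phi (plmul_rsym a b c); rewrite !(linB phiL) => RA.
have RB := plmul_rsym (phi a) (phi b) (phi c).
apply/eqP; rewrite -subr_eq0; apply/eqP; move: RA RB.
set u1 := phi (a ** b ** c); set u2 := phi (a ** (b ** c)).
set u3 := phi (a ** c ** b); set u4 := phi (a ** (c ** b)).
move=> RA RB; transitivity
  ((phi a ** phi b ** phi c - phi a ** (phi b ** phi c) -
    (phi a ** phi c ** phi b - phi a ** (phi c ** phi b))) -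
   (u1 - u2 - (u3 - u4))); first by zmod.
by rewrite RA RB !subrr.
Qed.

Lemma graded_defect_bounded p q x y : atleast gL p x -> atleast gL q y -> (m.+1 < p + q)%N ->
  graded_defect x y = 0.
Proof.
move=> xp yq pqm; rewrite /graded_defect big1 // => r _.
apply: graded_defect_term; first exact: leq_ord.
have [rp|pr] := ltnP r p; [by left; apply: xp | right; apply: yq].
rewrite -(ltn_add2l r) subnKC; last exact: leq_ord.
by apply: leq_trans pqm _; rewrite leq_add2r.
Qed.

(** The correction must leave phi unchanged in degree m: it is composed with the
    leading component of degree m + 1.  [H1] makes phi multiplicative, and the values
    on new generators are adjusted by a map that vanishes on products. *)
Lemma partial_extend : exists phi' : T -> B, partial_morphism m.+1 phi' /\
  forall s, leS m s -> phi' s = phi s.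
Proof.
have [h [hL hE]] := H1 graded_defect_bilin graded_defect_cocycle graded_defect_bounded.
(* The values that the map vanishing on products must take on new generators. *)
pose f0 x := if pselect (new_gens m x) is left H
  then f (existT _ m (exist _ x H)) - phi (lifting m.+1 x) - h (gL m.+1 x) else 0.
have [h' [h'L h'0 h'E]] := new_gens_ext m f0.
pose phi' s := phi s + h (lead m.+1 s) + h' (lead m.+1 s).
have low s : leS m s -> phi' s = phi s.
  by move=> sm; rewrite /phi' (lead_atmost sm) // (lin0 hL) (lin0 h'L) !addr0.
exists phi'; split=> //; split=> [c x y|p q a b pa qb|j g].
- by rewrite /phi' phiL lead_lin hL h'L !scalerDr; zmod.
- rewrite leq_eqVlt => /orP[/eqP pqm|pqm]; last first.
    rewrite ltnS in pqm.
    have pm := leq_trans (leq_addr q p) pqm; have qm := leq_trans (leq_addl p q) pqm.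
    rewrite !low; try by [apply: atmost_mono pa | apply: atmost_mono qb].
      exact: (pm_mul phiP pa qb).
    exact: atmost_mono pqm (leS_mul pa qb).
  have [p0|p0] := posnP p.
    have -> : a = 0 by apply: leS_0; rewrite -p0.
    by rewrite !pm0l /phi' (lin0 phiL) (lin0 (lead_lin _)) (lin0 hL) (lin0 h'L) !addr0 pm0l.
  have [q0|q0] := posnP q.
    have -> : b = 0 by apply: leS_0; rewrite -q0.
    by rewrite !pm0r /phi' (lin0 phiL) (lin0 (lead_lin _)) (lin0 hL) (lin0 h'L) !addr0 pm0r.
  have pm : (p <= m)%N by rewrite -ltnS -pqm -[X in (X < _)%N]addn0 ltn_add2l.
  have qm : (q <= m)%N by rewrite -ltnS -pqm -[X in (X < _)%N]add0n ltn_add2r.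
  rewrite [phi' a]low; last exact: atmost_mono pa.
  rewrite [phi' b]low; last exact: atmost_mono qb.
  rewrite /phi' -pqm lead_mul // -hE graded_defect_lead // h'0.
    by rewrite /defect addr0 addrC subrK.
  rewrite /decomposable -pqm.
  have -> : gL (p + q)%N (lead p a ** lead q b) = lead p a ** lead q b.
    by apply: hom_mul; apply: lead_hom.
  by apply: span_gen; exists (lead p a), (lead q b).
rewrite ltnS leq_eqVlt => /orP[/eqP jm|jm].
  case: g => x xg; rewrite /generator_val /= /phi' in xg *; subst j.
  rewrite lead_lifting; have -> : h' (gL m.+1 x) = h' x.
    apply/eqP; rewrite -subr_eq0 -(linB h'L) h'0 //.
    rewrite /decomposable (linB (pr_lin gL _)) hom_pr subrr; exact: span0.
  rewrite h'E // /f0; case: pselect => // xg'.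
  by rewrite (Prop_irrelevance xg' xg); zmod.
rewrite low; first exact: (pm_gen phiP).
by apply: atmost_mono (lifting_atmost _ _).
Qed.

End Defect.

Lemma partial_0 : partial_morphism 0 (fun=> 0).
Proof. by split=> [c x y|p q a b *|//]; rewrite ?scaler0 ?addr0 ?pm0l. Qed.

Fixpoint approx n : {phi | partial_morphism n phi} :=
  if n is n'.+1 then
    exist _ _ (proj1 (projT2 (cid (partial_extend (svalP (approx n'))))))
  else exist _ _ partial_0.

Lemma approx_stable n m s : (m <= n)%N -> leS m s -> sval (approx n) s = sval (approx m) s.
Proof.
move=> mn sm; elim: n mn => [|n IH]; first by rewrite leqn0 => /eqP->.
rewrite leq_eqVlt => /orP[/eqP->//|mn]; rewrite -IH //=.
by case: cid => phi [phiP /= ->] //; apply: atmost_mono sm.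
Qed.

Definition height s := projT1 (cid (atmost_ex gr (val s))).

Lemma heightP s : leS (height s) s.
Proof. by rewrite /leS /height; case: cid. Qed.

Arguments heightP : clear implicits.

Definition extension s : B := sval (approx (height s)) s.

Lemma extensionE n s : leS n s -> extension s = sval (approx n) s.
Proof.
move=> sn; rewrite /extension -(approx_stable (leq_maxl _ n) (heightP s)).
by rewrite (approx_stable (leq_maxr _ _) sn).
Qed.

Lemma extension_morphism : prelie_morphism extension.
Proof.
split=> [c x y|x y].
  pose n := maxn (height x) (height y).
  have xn : leS n x by apply: atmost_mono (heightP x); apply: leq_maxl.
  have yn : leS n y by apply: atmost_mono (heightP y); apply: leq_maxr.
  have xyn : leS n (c *: x + y) by case: (leS_sub n) => _; apply.
  by rewrite !(@extensionE n) // (pm_lin (svalP (approx n))).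
pose n := (height x + height y)%N.
have xn : leS n x by apply: atmost_mono (heightP x); apply: leq_addr.
have yn : leS n y by apply: atmost_mono (heightP y); apply: leq_addl.
have xyn : leS n (x ** y) by apply: leS_mul; apply: heightP.
rewrite !(@extensionE n) //.
exact: (pm_mul (svalP (approx n)) (heightP x) (heightP y)).
Qed.

Lemma extension_generator_val g : extension (generator_val g) = f g.
Proof.
case: g => m g; rewrite (@extensionE m.+1); last exact: lifting_atmost.
exact: (pm_gen (svalP (approx m.+1))).
Qed.

(** By induction on the degree: the leading component of s is a combination of products
    and of new generators, so s differs from a combination of products and generators
    of S by an element of lower degree. *)
Lemma extension_unique (psi psi' : T -> B) : prelie_morphism psi ->
  prelie_morphism psi' ->
  (forall g, psi (generator_val g) = psi' (generator_val g)) -> psi =1 psi'.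
Proof.
move=> [pL pM] [p'L p'M] pg.
suff main m s : leS m s -> psi s = psi' s by move=> s; apply: main (heightP s).
elim: m s => [|m IH] s sm; first by rewrite (leS_0 sm) (lin0 pL) (lin0 p'L).
have eqs : subspace (fun s => psi s = psi' s) by apply: eq_linear_sub.
have eqsg : subspace (fun x => psi (lifting m.+1 x) = psi' (lifting m.+1 x)).
  by apply: eq_linear_sub => c x y; rewrite lifting_lin ?pL ?p'L.
have shift a b : leS m.+1 a -> leS m.+1 b -> lead m.+1 a = lead m.+1 b ->
    psi b = psi' b -> psi a = psi' a.
  move=> am bm ab Eb; rewrite -[a](subrK b).
  apply: (sub_D eqs) Eb; apply: IH; apply: lead0.
    exact: (sub_B (leS_sub _)).
  by rewrite (linB (lead_lin _)) ab subrr.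
have onprods x : span (@prods k L) x -> psi (lifting m.+1 x) = psi' (lifting m.+1 x).
  move: x; apply: (span_sub eqsg) => _ [y [z ->]].
  have eqy : subspace (fun y => psi (lifting m.+1 (y ** z)) = psi' (lifting m.+1 (y ** z))).
    by apply: eq_linear_sub => c u v; rewrite plmul_linearl lifting_lin ?pL ?p'L.
  apply: (hom_ind (gr := gL) eqy) => p {}y yp.
  have eqz : subspace (fun z => psi (lifting m.+1 (y ** z)) = psi' (lifting m.+1 (y ** z))).
    by apply: eq_linear_sub => c u v; rewrite plmul_linearr lifting_lin ?pL ?p'L.
  apply: (hom_ind (gr := gL) eqz) => q t tq.
  have [p0|p0] := posnP p.
    have -> : y = 0 by apply: (@hom_0 _ _ gL); rewrite -p0.
    by rewrite pm0l; apply: sub_0 eqsg.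
  have [q0|q0] := posnP q.
    have -> : t = 0 by apply: (@hom_0 _ _ gL); rewrite -q0.
    by rewrite pm0r; apply: sub_0 eqsg.
  have [pqm|pqm] := eqVneq (p + q)%N m.+1; last first.
    apply: IH; apply: lead0 (lifting_atmost _ _) _.
    by rewrite lead_lifting (pr_hom _ (hom_mul yp tq)) eq_sym (negbTE pqm).
  apply: (shift _ (lifting p y ** lifting q t)); first exact: lifting_atmost.
  - by rewrite -pqm; apply: leS_mul; apply: lifting_atmost.
  - rewrite lead_lifting -pqm lead_mul ?lead_lifting ?yp ?tq; try exact: lifting_atmost.
    exact: hom_mul.
  - have pm : (p <= m)%N by rewrite -ltnS -pqm -[X in (X < _)%N]addn0 ltn_add2l.
    have qm : (q <= m)%N by rewrite -ltnS -pqm -[X in (X < _)%N]add0n ltn_add2r.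
    rewrite pM p'M !IH //; first by apply: atmost_mono (lifting_atmost _ _).
    by apply: atmost_mono (lifting_atmost _ _).
apply: (shift _ (lifting m.+1 (lead m.+1 s))) => //; first exact: lifting_atmost.
  by rewrite lead_lifting lead_hom.
apply: (span_sub eqsg) (new_gens_span m _) => x [xd|xg].
  apply: (shift _ (lifting m.+1 (gL m.+1 x))); try exact: lifting_atmost.
    by rewrite !lead_lifting hom_pr.
  exact: onprods.
exact: (pg (existT _ m (exist _ x xg))).
Qed.

End Extension.

Theorem lifted_free : is_free T.
Proof.
exists generator, generator_val => B f; exists (extension f).
split; [exact: extension_morphism | exact: extension_generator_val | move=> psi psiM psiE].
apply: extension_unique => //; first exact: extension_morphism.
by move=> g; rewrite psiE extension_generator_val.
Qed.

End Lifting.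

Theorem theorem5p1 (k : fieldType) (hk : [pchar k]%R =i pred0) :
  prelie_nielsen_schreier k.
Proof.
move=> A [X [i Afree]] S; have [gr] := free_grading Afree.
apply: (@lifted_free k A gr S) => m.
have [pi [piL piK piP]] := graded_retraction gr S.
pose iota (x : subprelie_type (grS gr S)) : A := val x.
have iotaL : linear iota by move=> c x y; rewrite /iota linearP.
by apply: (H1vanish_all hk Afree (gA := gr) iotaL).
Qed.
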